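(* Let $f\in L^\infty(\mathbb{R})$. Let $g\in L^1(\mathbb{R})$. Let $h\in C^1(\mathbb{R})$ be such that $h'$ is absolutely continuous and $h,h',h''\in L^1(\mathbb{R})$. Then $$\int_{-\infty}^\infty\hat f\,(g\ast h)=\int_{-\infty}^\infty f(t)\hat g(t)\hat h(t)\,dt,$$ where the left side is the distributional integral of $\hat f$ against $g\ast h$.
   Context: Functions are complex-valued; for $g\in L^1(\mathbb{R})$, $\hat g(s)=\int_{-\infty}^\infty e^{-ist}g(t)\,dt$; $g\ast h(x)=\int_{-\infty}^\infty g(s)h(x-s)\,ds$. For $f\in L^\infty(\mathbb{R})$ put $\hat f_1(s)=\int_{-1}^1e^{-ist}f(t)\,dt$ and $\Psi_f(s)=\int_{|t|>1}e^{-ist}f(t)\,\frac{dt}{t^2}$ (continuous, vanishing at $\pm\infty$). The Fourier transform of $f$ is the tempered distribution $\hat f=\hat f_1+\hat f_2$ with $\hat f_2=-\Psi_f''$ (second distributional derivative). Distributional integral: for absolutely continuous $u\in L^1(\mathbb{R})$ whose derivative is (a.e.) a right continuous function $v$ of bounded variation, $\int_{-\infty}^\infty\hat f u$ is defined as $\int_{-\infty}^\infty\hat f_1(s)u(s)\,ds-\int_{-\infty}^\infty\Psi_f(t)\,dv(t)$, the last integral being a Stieltjes integral. *)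

(* Defs.v *)
(* MathComp-Analysis *)
From HB Require Import structures.
From mathcomp Require Import all_boot all_order all_algebra.
From mathcomp Require Import all_classical all_reals all_analysis.
From mathcomp Require Import complex.

Set Implicit Arguments.
Unset Strict Implicit.
Unset Printing Implicit Defensive.
Import Order.TTheory GRing.Theory Num.Theory.
Import numFieldNormedType.Exports.

Local Open Scope classical_set_scope.
Local Open Scope complex_scope.
Local Open Scope ring_scope.

(* The library has integrals, L^p spaces, derivatives and variations for
   real-valued functions; a function R -> R[i] is treated through its real and
   imaginary parts. *)

Definition re_part (T : Type) (R : realType) (f : T -> R[i]) : T -> R :=
  fun x => complex.Re (f x).

Definition im_part (T : Type) (R : realType) (f : T -> R[i]) : T -> R :=
  fun x => complex.Im (f x).

Definition on_parts (R : realType) (P : (R -> R) -> Prop) (f : R -> R[i]) :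
    Prop :=
  P (re_part f) /\ P (im_part f).

Definition cintegral (d : measure_display) (T : measurableType d)
    (R : realType) (mu : {measure set T -> \bar R}) (D : set T)
    (f : T -> R[i]) : R[i] :=
  (\int[mu]_(x in D) re_part f x)%R +i* (\int[mu]_(x in D) im_part f x)%R.

(* Elements of L^1 and L^oo are given by Borel representatives, as in the
   library; everything below depends only on their classes. *)

Definition L1 (R : realType) (f : R -> R[i]) : Prop :=
  on_parts (fun u : R -> R => u \in Lfun (@lebesgue_measure R) 1%E) f.

Definition Linfty (R : realType) (f : R -> R[i]) : Prop :=
  on_parts (fun u : R -> R => u \in Lfun (@lebesgue_measure R) +oo%E) f.

Definition has_deriv (R : realType) (u : R -> R[i]) (x : R) (l : R[i]) : Prop :=
  is_derive x 1 (re_part u) (complex.Re l) /\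
  is_derive x 1 (im_part u) (complex.Im l).

(* Absolute continuity on [a, b]: the k-th interval is [p k, q k]. *)
Definition abs_cont_on (R : realType) (a b : R) (u : R -> R) : Prop :=
  forall e : R, 0 < e -> exists2 delta : R, 0 < delta &
    forall (n : nat) (p q : 'I_n -> R),
      (forall k, a <= p k /\ p k <= q k /\ q k <= b) ->
      (forall j k, j != k -> q j <= p k \/ q k <= p j) ->
      \sum_(k < n) (q k - p k) < delta ->
      \sum_(k < n) `|u (q k) - u (p k)| < e.

(* On the whole line, absolute continuity is that on every compact interval. *)
Definition abs_cont (R : realType) (u : R -> R) : Prop :=
  forall a b : R, abs_cont_on a b u.

Definition bounded_var (R : realType) (u : R -> R) : Prop :=
  exists M : R, forall a b : R, a <= b -> (total_variation a b u <= M%:E)%E.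

Definition expmi (R : realType) (x : R) : R[i] := cos x -i* sin x.

Definition fourier (R : realType) (g : R -> R[i]) (s : R) : R[i] :=
  cintegral (@lebesgue_measure R) setT (fun t => expmi (s * t) * g t).

Definition convolution (R : realType) (g h : R -> R[i]) (x : R) : R[i] :=
  cintegral (@lebesgue_measure R) setT (fun s => g s * h (x - s)).

Definition fourier1 (R : realType) (f : R -> R[i]) (s : R) : R[i] :=
  cintegral (@lebesgue_measure R) `[-1, 1] (fun t => expmi (s * t) * f t).

Definition Psi (R : realType) (f : R -> R[i]) (s : R) : R[i] :=
  cintegral (@lebesgue_measure R) [set t | 1 < `|t|]
    (fun t => expmi (s * t) * f t / ((t ^+ 2)%:C)).

(* Lebesgue-Stieltjes integral over the line of a bounded continuous function
   against a real right continuous v of bounded variation, written as a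
   difference of bounded nondecreasing right continuous functions; the value
   does not depend on the decomposition. *)
Definition is_stieltjesR (R : realType) (phi : R -> R[i]) (v : R -> R)
    (I : R[i]) : Prop :=
  exists F G : cumulative R R,
    [/\ bounded_fun F, bounded_fun G,
        forall x, v x = F x - G x &
        I = cintegral (lebesgue_stieltjes_measure F) setT phi
          - cintegral (lebesgue_stieltjes_measure G) setT phi].

Definition is_stieltjes (R : realType) (phi v : R -> R[i]) (I : R[i]) : Prop :=
  exists I1 I2 : R[i],
    [/\ is_stieltjesR phi (re_part v) I1,
        is_stieltjesR phi (im_part v) I2 &
        I = I1 + (0 +i* 1) * I2].

(* The distributional integral of the Fourier transform of f against u is
   defined and has value I. The function v and the value I are unique. *)
Definition is_distr_integral (R : realType) (f u : R -> R[i]) (I : R[i]) :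
    Prop :=
  L1 u /\ on_parts (@abs_cont R) u /\
  exists v : R -> R[i],
    [/\ {ae @lebesgue_measure R, forall x, has_deriv u x (v x)},
        on_parts (fun w : R -> R => right_continuous w) v,
        on_parts (@bounded_var R) v &
        exists2 J : R[i], is_stieltjes (Psi f) v J &
          I = cintegral (@lebesgue_measure R) setT (fun s => fourier1 f s * u s)
            - J].

(* Main.v *)
(* Split f at |t| = 1 into k1 = f on [-1, 1] and k2 = f / t^2 outside; both are
   integrable, \hat f_1 = \hat k1 and Psi_f = \hat k2. With u = g * h, v = g * h'
   and w = g * h'', Fubini shows that v is the derivative of u and that v is a
   primitive of the integrable function w, so the Stieltjes integral of Psi_f
   against dv is the integral of \hat k2 w. Exchanging the hat twice, the left
   side becomes the integral of k1 \hat u - k2 \hat w, where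
   \hat u = \hat g \hat h and \hat w = - t^2 \hat g \hat h. *)

Require Import Defs.
From HB Require Import structures.
From mathcomp Require Import all_boot all_order all_algebra.
From mathcomp Require Import all_classical all_reals all_analysis.
From mathcomp Require Import measurable_realfun ess_sup_inf complex.
From mathcomp Require Import ring lra.

Import Order.TTheory GRing.Theory Num.Theory.
Import numFieldNormedType.Exports.

Local Open Scope classical_set_scope.
Local Open Scope complex_scope.
Local Open Scope ring_scope.

Set Implicit Arguments.
Unset Strict Implicit.
Unset Printing Implicit Defensive.

(** The hypotheses give h'' only almost everywhere and the absolute continuity of h' in
    epsilon-delta form. What is used afterwards is the integral form, in which increments are
    integrals of an L^1 function: Fubini carries it through convolution with a merely integrable g.
    Reaching it for h' is the main real-variable difficulty: a function with derivative 0 almost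
    everywhere must be controlled across a null set, by an open cover of small measure and a sweep
    of the interval. The transform of a derivative is found without integration by parts or decay at
    infinity: the increment of h over half a period of the exponential is a convolution. This needs
    t nonzero, and at t = 0 the factor k2 vanishes. The measure dv is reached by splitting v into
    two monotone primitives, whose Stieltjes measures have Lebesgue densities. Since f is only
    essentially bounded, k1 and k2 are built from a representative bounded at every point, so that
    all dominations are pointwise. *)

Section almost_everywhere.
Context d (T : measurableType d) (R : realType).
Variable mu : {measure set T -> \bar R}.

Lemma ae_imply (P Q : T -> Prop) : (forall x, P x -> Q x) ->
  {ae mu, forall x, P x} -> {ae mu, forall x, Q x}.
Proof. by move=> PQ; apply: filterS. Qed.

Lemma ae_all (P : T -> Prop) : (forall x, P x) -> {ae mu, forall x, P x}.
Proof. by move=> h; apply: nearW. Qed.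

Lemma ae_imply2 (P Q S : T -> Prop) : (forall x, P x -> Q x -> S x) ->
  {ae mu, forall x, P x} -> {ae mu, forall x, Q x} -> {ae mu, forall x, S x}.
Proof. by move=> PQS; apply: filterS2. Qed.

(** The norm at exponent [+oo] unfolds to an essential supremum when the space has positive measure,
    hence the condition on [mu setT]. *)
Lemma Linfty_ae_bounded (f : T -> R) : (0 < mu setT)%E ->
  f \in Lfun mu +oo%E ->
  measurable_fun setT f /\ exists M, {ae mu, forall x, `|f x| <= M}.
Proof.
move=> muT; rewrite inE => /andP[mf]; rewrite inE /= /finite_norm unlock muT.
move=> fy; split; first by rewrite inE in mf.
exact: (@ess_supr_bounded _ _ _ mu (Num.norm \o f)).
Qed.

End almost_everywhere.

(** * Integration of complex functions through real and imaginary parts *)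

Section complex_integral.
Context d (T : measurableType d) (R : realType).
Implicit Types (F G : T -> R[i]) (z w : R[i]).

(* Stands for the modulus, so that bounds split into real and imaginary parts. *)
Definition norm1 (z : R[i]) : R := `|complex.Re z| + `|complex.Im z|.

Lemma norm1_ge0 z : 0 <= norm1 z.
Proof. by rewrite addr_ge0. Qed.

Lemma norm1M z w : norm1 (z * w) <= norm1 z * norm1 w.
Proof.
case: z w => a b [c e]; rewrite /norm1 /= mulrDl !mulrDr -!normrM.
have h1 := ler_normB (a * c) (b * e); have h2 := ler_normD (a * e) (b * c).
by lra.
Qed.

Definition cmeasurable F :=
  measurable_fun setT (re_part F) /\ measurable_fun setT (im_part F).

Lemma cmeasurableM F G :
  cmeasurable F -> cmeasurable G -> cmeasurable (fun x => F x * G x).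
Proof.
move=> [F1 F2] [G1 G2]; split.
  apply: (eq_measurable_fun
    (fun x => re_part F x * re_part G x - im_part F x * im_part G x)).
    by move=> x _; rewrite /re_part /im_part; case: (F x) (G x) => a b [].
  by apply: measurable_funB; apply: measurable_funM.
apply: (eq_measurable_fun
  (fun x => re_part F x * im_part G x + im_part F x * re_part G x)).
  by move=> x _; rewrite /re_part /im_part; case: (F x) (G x) => a b [].
by apply: measurable_funD; apply: measurable_funM.
Qed.

Lemma cmeasurable_cst z : cmeasurable (fun=> z).
Proof. by split; exact: measurable_cst. Qed.

Lemma measurable_norm1 F :
  cmeasurable F -> measurable_fun setT (fun x => norm1 (F x)).
Proof.
by move=> [F1 F2]; apply: measurable_funD; apply: measurableT_comp.
Qed.

Variable mu : {measure set T -> \bar R}.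

Definition cintegrable F :=
  mu.-integrable setT (EFin \o re_part F) /\
  mu.-integrable setT (EFin \o im_part F).

Definition cint F := cintegral mu setT F.

Lemma cintegrable_measurable F : cintegrable F -> cmeasurable F.
Proof.
by move=> [/measurable_int/measurable_EFinP ? /measurable_int/measurable_EFinP].
Qed.

Lemma le_cintegrable F (b : T -> R) : cmeasurable F ->
  (forall x, norm1 (F x) <= b x) -> mu.-integrable setT (EFin \o b) ->
  cintegrable F.
Proof.
move=> [F1 F2] Fb ib; split; apply: (le_integrable _ _ _ ib) => //.
- exact/measurable_EFinP.
- move=> x _; rewrite /= lee_fin; apply: le_trans (ler_norm _).
  by apply: le_trans (Fb x); rewrite lerDl.
- exact/measurable_EFinP.
- move=> x _; rewrite /= lee_fin; apply: le_trans (ler_norm _).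
  by apply: le_trans (Fb x); rewrite lerDr.
Qed.

Lemma cintegrable_norm1 F : cintegrable F ->
  mu.-integrable setT (fun x => (norm1 (F x))%:E).
Proof.
move=> [F1 F2]; apply: (eq_integrable measurableT
  ((abse \o (EFin \o re_part F)) \+ (abse \o (EFin \o im_part F)))%E) => //.
by apply: integrableD => //; exact: integrable_abse.
Qed.

Lemma norm1_cint F : cintegrable F ->
  norm1 (cint F) <= \int[mu]_x norm1 (F x).
Proof.
move=> [F1 F2]; rewrite RintegralD//; last 2 first.
- exact: integrable_norm.
- exact: integrable_norm.
by apply: lerD; apply: le_normr_Rintegral.
Qed.

Lemma cintegrableM_bounded F G (M : R) : cintegrable F -> cmeasurable G ->
  (forall x, norm1 (G x) <= M) -> cintegrable (fun x => F x * G x).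
Proof.
move=> iF mG GM; apply: (@le_cintegrable _ (fun x => M * norm1 (F x))).
- exact/cmeasurableM/mG/cintegrable_measurable.
- move=> x; apply: le_trans (norm1M _ _) _.
  by rewrite mulrC ler_wpM2r// norm1_ge0.
- exact: (integrableZl measurableT M (cintegrable_norm1 iF)).
Qed.

Lemma cintegrableZ z F : cintegrable F -> cintegrable (fun x => z * F x).
Proof.
move=> iF; have -> : (fun x => z * F x) = fun x => F x * z.
  by apply/funext => x; rewrite mulrC.
by apply: (@cintegrableM_bounded _ _ (norm1 z)) => //; exact: cmeasurable_cst.
Qed.

Lemma cintegrableD F G :
  cintegrable F -> cintegrable G -> cintegrable (fun x => F x + G x).
Proof.
move=> [F1 F2] [G1 G2]; split.
  apply: eq_integrable (integrableD measurableT F1 G1) => // x _.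
  by rewrite /re_part /=; case: (F x) (G x) => ? ? [].
apply: eq_integrable (integrableD measurableT F2 G2) => // x _.
by rewrite /im_part /=; case: (F x) (G x) => ? ? [].
Qed.

Lemma eq_cint F G : F =1 G -> cint F = cint G.
Proof. by move=> /funext ->. Qed.

Lemma cintD F G : cintegrable F -> cintegrable G ->
  cint (fun x => F x + G x) = cint F + cint G.
Proof.
move=> [F1 F2] [G1 G2]; rewrite /cint /cintegral.
apply/eqP; rewrite eq_complex /=; apply/andP; split; apply/eqP.
  rewrite -RintegralD//; apply: eq_Rintegral => x _.
  by rewrite /re_part; case: (F x) (G x) => ? ? [].
rewrite -RintegralD//; apply: eq_Rintegral => x _.
by rewrite /im_part; case: (F x) (G x) => ? ? [].
Qed.

Lemma cintZ z F : cintegrable F -> cint (fun x => z * F x) = z * cint F.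
Proof.
move=> [F1 F2]; rewrite /cint /cintegral; case: z => a b.
have iZ (k : R) (f : T -> R) : mu.-integrable setT (EFin \o f) ->
    mu.-integrable setT (EFin \o (fun x => k * f x)).
  by move=> h; exact: (integrableZl measurableT k h).
apply/eqP; rewrite eq_complex /=; apply/andP; split; apply/eqP.
  rewrite -!RintegralZl// -RintegralB//; [|exact: iZ|exact: iZ].
  by apply: eq_Rintegral => x _; rewrite /re_part /im_part; case: (F x).
rewrite -!RintegralZl// -RintegralD//; [|exact: iZ|exact: iZ].
by apply: eq_Rintegral => x _; rewrite /re_part /im_part; case: (F x).
Qed.

Lemma ae_eq_cint F G : cmeasurable F -> cmeasurable G ->
  {ae mu, forall x, F x = G x} -> cint F = cint G.
Proof.
move=> [F1 F2] [G1 G2] FG; rewrite /cint /cintegral /Rintegral.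
congr (fine _ +i* fine _); apply: ae_eq_integral => //;
  try exact/measurable_EFinP.
  by apply: filterS FG => x FG _; rewrite /re_part FG.
by apply: filterS FG => x FG _; rewrite /im_part FG.
Qed.

Lemma cintegral_mkcond (D : set T) F :
  cintegral mu D F = cint (fun x => (\1_D x)%:C * F x).
Proof.
rewrite /cint /cintegral; congr (_ +i* _); rewrite Rintegral_mkcond;
  apply: eq_Rintegral => x _; rewrite patchE /re_part /im_part indicE;
  by case: ifP => xD; rewrite ?xD /=; case: (F x) => a b /=;
  rewrite ?mul1r ?mul0r ?subr0 ?addr0.
Qed.

End complex_integral.

(** * From extended real to real inner integrals *)

Section fine_integral.
Context d (T : measurableType d) (R : realType).
Variable mu : {measure set T -> \bar R}.
Local Open Scope ereal_scope.

Lemma integrable_fine (f : T -> \bar R) : mu.-integrable setT f ->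
  mu.-integrable setT (EFin \o (fine \o f)).
Proof.
move=> fi; have mf := measurable_int _ fi.
apply: (le_integrable measurableT _ _ fi).
  by apply/measurable_EFinP; apply: measurableT_comp.
by move=> x _ /=; case: (f x) => [r||] //=; rewrite ?normr0 leey.
Qed.

(** An inner Fubini integral may be infinite at some points, where [fine] returns 0; integrability
    confines these points to a null set. *)
Lemma integral_fine (f : T -> \bar R) : mu.-integrable setT f ->
  \int[mu]_x (fine (f x))%:E = \int[mu]_x f x.
Proof.
move=> fi; have mf := measurable_int _ fi.
apply: ae_eq_integral => //.
  by apply/measurable_EFinP; apply: measurableT_comp.
apply: filterS (integrable_ae measurableT fi) => x fx _.
by rewrite fineK//; exact: fx.
Qed.

End fine_integral.

(** * Integrability on a product by domination *)

Section product_integrability.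
Context d1 d2 (T1 : measurableType d1) (T2 : measurableType d2) (R : realType).
Variable m1 : {sigma_finite_measure set T1 -> \bar R}.
Variable m2 : {sigma_finite_measure set T2 -> \bar R}.

(** Tonelli: integrating first in y leaves at most |a| B. Both double integrals of the proof fit:
    for the convolution c consists of translates, whose integrals are all equal, and for the
    exchange of the hat c depends on y alone. *)
Lemma integrable_prod_bound (a : T1 -> R) (c : T1 * T2 -> R) (B : R) :
  m1.-integrable setT (EFin \o a) -> measurable_fun setT c ->
  (forall x, \int[m2]_y `|(c (x, y))%:E| <= B%:E)%E ->
  (m1 \x m2)%E.-integrable setT (fun z => (a z.1 * c z)%:E).
Proof.
move=> ia mc cB; have ma := measurable_int _ ia.
have mac : measurable_fun setT (fun z : T1 * T2 => (a z.1 * c z)%:E).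
  apply/measurable_EFinP; apply: measurable_funM => //.
  by apply: measurableT_comp => //; exact/measurable_EFinP.
apply/integrable12ltyP => //.
have mcx x : measurable_fun setT (fun y => c (x, y)).
  by apply: measurableT_comp => //; exact: pair1_measurable.
move/integrableP : ia => [_ ia].
apply: (@le_lt_trans _ _ (\int[m1]_x (`|(a x)%:E| * B%:E))%E); last first.
  rewrite ge0_integralZr//; last 2 first.
  - exact: measurableT_comp.
  (* B is nonnegative because it bounds an integral at some point. *)
  - by apply: le_trans (cB point); exact: integral_ge0.
  rewrite lte_mul_pinfty ?ltry//; first exact: integral_ge0.
  by rewrite fin_numElt ia andbT (lt_le_trans _ (integral_ge0 _ _)).
apply: ge0_le_integral => //.
- by move=> x _; exact: integral_ge0.
- apply: (@measurable_fun_fubini_tonelli_F _ _ _ _ _ m2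
    (abse \o (fun z : T1 * T2 => (a z.1 * c z)%:E))) => //.
    exact: measurableT_comp.
  by move=> z; exact: abse_ge0.
- by apply: emeasurable_funM => //; apply: measurableT_comp.
- move=> x _ /=.
  under eq_integral do rewrite normrM EFinM.
  rewrite ge0_integralZl//; last first.
    by apply/measurable_EFinP; apply: measurableT_comp.
  by rewrite lee_wpmul2l ?lee_fin//; exact: cB.
Qed.

Lemma cintegrable_prod_bound (F : T1 * T2 -> R[i])
    (a : T1 -> R) (c : T1 * T2 -> R) (B : R) :
  cmeasurable F -> m1.-integrable setT (EFin \o a) -> measurable_fun setT c ->
  (forall x, \int[m2]_y `|(c (x, y))%:E| <= B%:E)%E ->
  (forall z, norm1 (F z) <= a z.1 * c z) -> cintegrable (m1 \x m2)%E F.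
Proof.
move=> mF ia mc cB Fac.
exact: (le_cintegrable mF Fac (integrable_prod_bound ia mc cB)).
Qed.

End product_integrability.

(** * Fubini for complex functions *)

Section complex_fubini.
Context d1 d2 (T1 : measurableType d1) (T2 : measurableType d2) (R : realType).
Variable m1 : {sigma_finite_measure set T1 -> \bar R}.
Variable m2 : {sigma_finite_measure set T2 -> \bar R}.
Variable F : T1 * T2 -> R[i].
Hypothesis iF : cintegrable (m1 \x m2)%E F.

Lemma cintegrable_fubini : cintegrable m1 (fun x => cint m2 (fun y => F (x, y))).
Proof.
case: iF => i1 i2; split.
  exact: integrable_fine (integrable_fubini_F i1).
exact: integrable_fine (integrable_fubini_F i2).
Qed.

(** Obtained from the other order of integration by swapping the coordinates. *)
Let integrable_fubini_G (f : T1 * T2 -> R) :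
  (m1 \x m2)%E.-integrable setT (EFin \o f) ->
  m2.-integrable setT (fun y => \int[m1]_x (f (x, y))%:E)%E.
Proof.
move=> fi; have mf := measurable_int _ fi.
apply: (@integrable_fubini_F _ _ _ _ _ m2 m1 (fun z => (f (z.2, z.1))%:E)).
apply/integrable12ltyP; first by apply: (measurableT_comp mf); exact: measurable_swap.
exact: (integrable21ltyP m1 m2 mf).1 fi.
Qed.

Lemma cintegrable_fubini2 : cintegrable m2 (fun y => cint m1 (fun x => F (x, y))).
Proof.
case: iF => i1 i2; split.
  exact: integrable_fine (integrable_fubini_G i1).
exact: integrable_fine (integrable_fubini_G i2).
Qed.

Lemma ae_cintegrable2 : {ae m2, forall y, cintegrable m1 (fun x => F (x, y))}.
Proof.
case: iF => /ae_integrable2 i1 /ae_integrable2 i2.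
by apply: filterS2 i1 i2 => y; split.
Qed.

Lemma cint_fubini :
  cint m1 (fun x => cint m2 (fun y => F (x, y))) =
  cint m2 (fun y => cint m1 (fun x => F (x, y))).
Proof.
case: iF => i1 i2; rewrite /cint /cintegral /Rintegral; congr (fine _ +i* fine _).
  rewrite (integral_fine (integrable_fubini_F i1)) (Fubini i1).
  by rewrite -[LHS](integral_fine (integrable_fubini_G i1)).
rewrite (integral_fine (integrable_fubini_F i2)) (Fubini i2).
by rewrite -[LHS](integral_fine (integrable_fubini_G i2)).
Qed.

End complex_fubini.

(** * Translation invariance *)

Section translation.
Context {R : realType}.
Local Notation lam := (@lebesgue_measure R).
Implicit Types F : measurableTypeR R -> R[i].

Lemma measurable_shift s :
  measurable_fun setT (fun x : measurableTypeR R => x - s : measurableTypeR R).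
Proof. exact: (@measurable_funB _ R R setT (fun x => x) (fun=> s)). Qed.

(** The translated measure gives half-open intervals their length, and this determines Lebesgue
    measure. *)
Lemma lebesgue_measure_shift s (A : set (measurableTypeR R)) : measurable A ->
  pushforward lam (fun x => x - s : measurableTypeR R) A = lam A.
Proof.
move=> mA; apply/esym/lebesgue_measure_unique => //=; first exact: measurable_shift.
move=> ms _ [[a b]] _ <-; rewrite /pushforward.
have -> : (fun x => x - s) @^-1` `]a, b]%classic = `]a + s, b + s]%classic.
  by apply/seteqP; split => x /=; rewrite !in_itv /= ltrBrDr lerBlDr.
rewrite !lebesgue_measure_itv /= !lte_fin ltrD2r -!EFinD.
by case: ifP => // _; congr _%:E; ring.
Qed.

Lemma ge0_integral_shift (f : measurableTypeR R -> \bar R) s :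
  measurable_fun setT f -> (forall x, 0 <= f x)%E ->
  (\int[lam]_x f (x - s)%R = \int[lam]_x f x)%E.
Proof.
move=> mf f0; have := ge0_integral_pushforward (measurable_shift s) lam
  (D := setT) measurableT mf (fun x _ => f0 x).
rewrite preimage_setT => <-.
apply: eq_measure_integral => //=; first exact: measurable_shift.
by move=> ms A mA _; exact: lebesgue_measure_shift.
Qed.

Lemma integral_shift (f : measurableTypeR R -> \bar R) s : measurable_fun setT f ->
  (\int[lam]_x f (x - s)%R = \int[lam]_x f x)%E.
Proof.
move=> mf; rewrite integralE [RHS]integralE; congr (_ - _)%E.
  by rewrite -[RHS](ge0_integral_shift s)//; [rewrite unlock|exact: measurable_funepos].
by rewrite -[RHS](ge0_integral_shift s)//; [rewrite unlock|exact: measurable_funeneg].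
Qed.

Lemma cmeasurable_shift F s :
  cmeasurable F -> cmeasurable (fun x : measurableTypeR R => F (x - s)).
Proof.
move=> [F1 F2]; split.
  exact: (measurableT_comp F1 (measurable_shift s)).
exact: (measurableT_comp F2 (measurable_shift s)).
Qed.

Lemma cint_shift F s : cmeasurable F ->
  cint lam (fun x => F (x - s)) = cint lam F.
Proof.
move=> [F1 F2]; rewrite /cint /cintegral /Rintegral; congr (fine _ +i* fine _).
  apply: (integral_shift (f := EFin \o re_part F)); exact/measurable_EFinP.
apply: (integral_shift (f := EFin \o im_part F)); exact/measurable_EFinP.
Qed.

End translation.

(** * Convolution, Fourier transform and the exchange of the hat *)

Section fourier_convolution.
Context {R : realType}.
Local Notation lam := (@lebesgue_measure R).
Implicit Types K g h k u : measurableTypeR R -> R[i].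

Lemma expmiD (s t : R) : expmi (s + t) = expmi s * expmi t :> R[i].
Proof.
apply/eqP; rewrite /expmi eq_complex /= cosD sinD; apply/andP.
by split; apply/eqP; ring.
Qed.

Lemma norm1_expmi (t : R) : norm1 (expmi t) <= 2.
Proof.
rewrite /norm1 /expmi /= normrN (_ : 2 = 1 + 1)//; apply: lerD; rewrite ler_norml.
  by rewrite cos_geN1 cos_le1.
by rewrite sin_geN1 sin_le1.
Qed.

Lemma cmeasurable_expmi d (T : measurableType d) (f : T -> R) :
  measurable_fun setT f -> cmeasurable (fun y => expmi (f y)).
Proof.
move=> mf; split.
  apply: (@measurableT_comp _ _ _ _ _ _ (@cos R)) => //.
  by apply: continuous_measurable_fun; exact: continuous_cos.
apply: (@measurableT_comp _ _ _ _ _ _ (@GRing.opp R \o @sin R)) => //.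
apply: measurableT_comp => //.
by apply: continuous_measurable_fun; exact: continuous_sin.
Qed.

Let m1 (F : measurableTypeR R -> R[i]) : cmeasurable F ->
  cmeasurable (fun z : measurableTypeR R * measurableTypeR R => F z.1).
Proof.
move=> [F1 F2]; split.
  exact: (measurableT_comp F1 measurable_fst).
exact: (measurableT_comp F2 measurable_fst).
Qed.

Let m2 (F : measurableTypeR R -> R[i]) : cmeasurable F ->
  cmeasurable (fun z : measurableTypeR R * measurableTypeR R => F z.2).
Proof.
move=> [F1 F2]; split.
  exact: (measurableT_comp F1 measurable_snd).
exact: (measurableT_comp F2 measurable_snd).
Qed.

Lemma integral_norm1_lty h : cintegrable lam h ->
  (\int[lam]_x `|(norm1 (h x))%:E| = (\int[lam]_x norm1 (h x))%:E)%E.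
Proof.
move=> ih; rewrite /Rintegral fineK; last first.
  by apply: integrable_fin_num => //; exact: cintegrable_norm1.
by apply: eq_integral => x _; rewrite /= ger0_norm ?norm1_ge0.
Qed.

(** The bounded weight K serves three purposes: K = 1 for the convolution itself, an exponential for
    its transform, and the indicator of an interval for its primitive. *)
Let integrable_conv_kernel K g h M : cmeasurable K ->
  (forall x, norm1 (K x) <= M) -> cintegrable lam g -> cintegrable lam h ->
  cintegrable (lam \x lam)%E (fun z => g z.1 * (K z.2 * h (z.2 - z.1))).
Proof.
move=> mK KM ig ih; have M0 : 0 <= M := le_trans (norm1_ge0 _) (KM 0).
have mg := cintegrable_measurable ig; have mh := cintegrable_measurable ih.
have msub : measurable_fun setT
    (fun z : measurableTypeR R * measurableTypeR R => z.2 - z.1 : R).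
  by apply: measurable_funB.
have mhs : cmeasurable
    (fun z : measurableTypeR R * measurableTypeR R => h (z.2 - z.1)).
  by case: mh => h1 h2; split;
    [apply: (measurableT_comp h1)|apply: (measurableT_comp h2)].
apply: (@cintegrable_prod_bound _ _ _ _ _ _ _ _ (fun s : measurableTypeR R => norm1 (g s))
    (fun z : measurableTypeR R * measurableTypeR R =>
       M * norm1 (h (z.2 - z.1)))
    (M * \int[lam]_x norm1 (h x))).
- by apply: cmeasurableM; [exact: m1|apply: cmeasurableM => //; exact: m2].
- exact: cintegrable_norm1.
- by apply: measurable_funM => //; exact: measurable_norm1.
- move=> s /=.
  under eq_integral do rewrite normrM EFinM.
  rewrite ge0_integralZl//; last first.
    apply/measurable_EFinP; apply: measurableT_comp => //.
    exact/measurable_norm1/cmeasurable_shift.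
  rewrite (ger0_norm M0) EFinM -integral_norm1_lty//.
  rewrite (ge0_integral_shift (f := fun x => `|norm1 (h x)|%:E) s)//.
  apply/measurable_EFinP; apply: measurableT_comp => //.
  exact/measurable_norm1.
- move=> z; apply: le_trans (norm1M _ _) _; rewrite ler_wpM2l ?norm1_ge0//.
  by apply: le_trans (norm1M _ _) _; rewrite ler_wpM2r ?norm1_ge0.
Qed.

Let integrable_conv g h : cintegrable lam g -> cintegrable lam h ->
  cintegrable (lam \x lam)%E (fun z => g z.1 * h (z.2 - z.1)).
Proof.
move=> ig ih.
have := integrable_conv_kernel (cmeasurable_cst _ 1) (fun=> lexx _) ig ih.
by congr (cintegrable _ _); apply/funext => z; rewrite mul1r.
Qed.

Lemma cintegrable_convolution g h : cintegrable lam g -> cintegrable lam h ->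
  cintegrable lam (convolution g h).
Proof. by move=> ig ih; exact: (cintegrable_fubini2 (integrable_conv ig ih)). Qed.

Lemma cint_convolution K g h M : cmeasurable K ->
  (forall x, norm1 (K x) <= M) -> cintegrable lam g -> cintegrable lam h ->
  cint lam (fun x => K x * convolution g h x) =
  cint lam (fun s => g s * cint lam (fun x => K x * h (x - s))).
Proof.
move=> mK KM ig ih; have iF := integrable_conv_kernel mK KM ig ih.
have mh := cintegrable_measurable ih.
transitivity (cint lam (fun x => cint lam (fun s => g s * (K x * h (x - s))))).
  (* K x moves under the integral in s only where that integrand is integrable, which Fubini grants
     for almost every x. *)
  apply: ae_eq_cint.
  - apply: cmeasurableM => //.
    exact/cintegrable_measurable/cintegrable_convolution.
  - exact: (cintegrable_measurable (cintegrable_fubini2 iF)).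
  - apply: filterS (ae_cintegrable2 (integrable_conv ig ih)) => x ix.
    rewrite -(cintZ (K x) ix); apply: eq_cint => s /=; ring.
rewrite -(cint_fubini iF); apply: eq_cint => s /=; rewrite cintZ//.
have : cintegrable lam (fun x => h (x - s)).
  apply: (le_cintegrable (b := fun x : measurableTypeR R => norm1 (h (x - s)))) => //.
    exact: cmeasurable_shift.
  apply/integrableP; split.
    by apply/measurable_EFinP/measurable_norm1/cmeasurable_shift.
  rewrite (ge0_integral_shift (f := fun x => `|norm1 (h x)|%:E) s)//.
    by rewrite (integral_norm1_lty ih) ltry.
  apply/measurable_EFinP; apply: measurableT_comp => //.
  exact/measurable_norm1.
move=> ihs; have := cintegrableM_bounded ihs mK KM.
by congr (cintegrable _ _); apply/funext => x; rewrite mulrC.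
Qed.

Lemma cintegrable_fourier_integrand g (t : R) : cintegrable lam g ->
  cintegrable lam (fun s => expmi (t * s) * g s).
Proof.
move=> ig; have -> : (fun s => expmi (t * s) * g s) =
   (fun s => g s * expmi (t * s)) by apply/funext => s; rewrite mulrC.
apply: (cintegrableM_bounded ig) => [|s]; last exact: norm1_expmi.
by apply: cmeasurable_expmi; apply: measurable_funM.
Qed.

Lemma fourier_convolution g h t : cintegrable lam g -> cintegrable lam h ->
  fourier (convolution g h) t = fourier g t * fourier h t.
Proof.
move=> ig ih; have mh := cintegrable_measurable ih.
rewrite {1}/fourier -/(cint lam _).
have me : cmeasurable (fun x : R => expmi (t * x)).
  by apply: cmeasurable_expmi; apply: measurable_funM.
rewrite (cint_convolution me (fun x => norm1_expmi _) ig ih).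
transitivity (cint lam (fun s => fourier h t * (expmi (t * s) * g s))).
  apply: eq_cint => s.
  have mF : cmeasurable (fun y : R => expmi (t * (y + s)) * h y).
    apply: cmeasurableM => //; apply: cmeasurable_expmi.
    by apply: measurable_funM => //; apply: measurable_funD.
  have -> : cint lam (fun x => expmi (t * x) * h (x - s)) =
            cint lam (fun y => expmi (t * (y + s)) * h y).
    by rewrite -(cint_shift s mF); apply: eq_cint => x; rewrite subrK.
  have -> : cint lam (fun y => expmi (t * (y + s)) * h y) =
            expmi (t * s) * fourier h t.
    rewrite -cintZ; last exact: cintegrable_fourier_integrand.
    by apply: eq_cint => x; rewrite mulrDr expmiD; ring.
  by ring.
by rewrite cintZ; [rewrite mulrC|exact: cintegrable_fourier_integrand].
Qed.

Let integrable_exchange_kernel k u : cintegrable lam k -> cintegrable lam u ->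
  cintegrable (lam \x lam)%E (fun z => u z.1 * (expmi (z.1 * z.2) * k z.2)).
Proof.
move=> ik iu.
have mk := cintegrable_measurable ik; have mu := cintegrable_measurable iu.
apply: (@cintegrable_prod_bound _ _ _ _ _ _ _ _ (fun s : measurableTypeR R => norm1 (u s))
    (fun z : measurableTypeR R * measurableTypeR R => 2 * norm1 (k z.2))
    (2 * \int[lam]_x norm1 (k x))).
- apply: cmeasurableM; first exact: m1.
  apply: cmeasurableM; last exact: m2.
  by apply: cmeasurable_expmi; apply: measurable_funM.
- exact: cintegrable_norm1.
- by apply: measurable_funM => //; apply: measurable_norm1; exact: m2.
- move=> s /=.
  under eq_integral do rewrite normrM EFinM.
  rewrite ge0_integralZl//; last first.
    by apply/measurable_EFinP; apply: measurableT_comp => //; exact/measurable_norm1.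
  by rewrite (ger0_norm (ler0n _ 2)) EFinM -integral_norm1_lty.
- move=> z; apply: le_trans (norm1M _ _) _; rewrite ler_wpM2l ?norm1_ge0//.
  apply: le_trans (norm1M _ _) _; rewrite ler_wpM2r ?norm1_ge0//.
  exact: norm1_expmi.
Qed.

Let exchange_inner k u s : cintegrable lam k ->
  cint lam (fun t => u s * (expmi (s * t) * k t)) = fourier k s * u s.
Proof.
by move=> ik; rewrite cintZ; [rewrite mulrC|exact: cintegrable_fourier_integrand].
Qed.

Lemma cintegrable_fourierM k u : cintegrable lam k -> cintegrable lam u ->
  cintegrable lam (fun s => fourier k s * u s).
Proof.
move=> ik iu; have := cintegrable_fubini (integrable_exchange_kernel ik iu).
by congr (cintegrable _ _); apply/funext => s; exact: exchange_inner.
Qed.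

(** Fubini, the kernel [expmi (s * t)] being symmetric in s and t. *)
Lemma cint_fourierM k u : cintegrable lam k -> cintegrable lam u ->
  cint lam (fun s => fourier k s * u s) = cint lam (fun t => k t * fourier u t).
Proof.
move=> ik iu.
transitivity (cint lam (fun s =>
    cint lam (fun t => u s * (expmi (s * t) * k t)))).
  by apply: eq_cint => s; rewrite exchange_inner.
rewrite [LHS](cint_fubini (integrable_exchange_kernel ik iu)).
apply: eq_cint => t /=; rewrite -cintZ; last exact: cintegrable_fourier_integrand.
by apply: eq_cint => s; rewrite (mulrC t); ring.
Qed.

Lemma integrable_oneDsqrV : lam.-integrable setT (EFin \o (fun x : R => (1 + x ^+ 2)^-1)).
Proof.
have mf : measurable_fun setT (fun x : R => (1 + x ^+ 2)^-1).
  by apply: continuous_measurable_fun; exact: continuous_oneDsqrV.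
have f0 (x : R) : 0 <= (1 + x ^+ 2)^-1 by rewrite invr_ge0 addr_ge0// sqr_ge0.
apply/integrableP; split; first exact/measurable_EFinP.
under eq_integral do rewrite gee0_abs ?lee_fin ?f0//.
rewrite ge0_symfun_integralT//.
- by have := @integral0y_oneDsqr R; rewrite set_itvcy => ->; rewrite ltry.
- exact: continuous_oneDsqrV.
- by move=> x; rewrite /= sqrrN.
Qed.

(* Fubini gives measurability of the product with an integrable function only,
   hence the detour through 1 / (1 + x^2). *)
Lemma cmeasurable_fourier k : cintegrable lam k -> cmeasurable (fourier k).
Proof.
move=> ik; pose u x : R[i] := ((1 + x ^+ 2)^-1)%:C.
have iu : cintegrable lam u.
  split; first exact: integrable_oneDsqrV.
  by rewrite (_ : _ \o _ = cst 0%E)//; exact: integrable0.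
have mD : cmeasurable (fun x : R => (1 + x ^+ 2)%:C : R[i]).
  split; last exact: measurable_cst.
  by apply: measurable_funD => //; apply: measurable_funX.
have := cmeasurableM (cintegrable_measurable (cintegrable_fourierM ik iu)) mD.
congr (cmeasurable _); apply/funext => x; rewrite -mulrA -rmorphM /=.
by rewrite mulVf ?mulr1// gt_eqF// ltr_wpDr// sqr_ge0.
Qed.

Lemma norm1_fourier k s : cintegrable lam k ->
  norm1 (fourier k s) <= 2 * \int[lam]_x norm1 (k x).
Proof.
move=> ik; have i1 := cintegrable_fourier_integrand s ik.
apply: le_trans (norm1_cint i1) _.
rewrite -RintegralZl//; last exact: cintegrable_norm1.
apply: le_Rintegral => //; first exact: cintegrable_norm1.
  exact: (integrableZl measurableT 2 (cintegrable_norm1 ik)).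
move=> x _; apply: le_trans (norm1M _ _) _.
by rewrite ler_wpM2r ?norm1_ge0// norm1_expmi.
Qed.

End fourier_convolution.

(** * Primitives and the fundamental theorem for absolutely continuous functions *)

Section primitives.
Context {R : realType}.
Local Notation lam := (@lebesgue_measure R).
Implicit Types (U V f : R -> R) (a b c x y : R).

(** Stated by increments so that no base point or limit at infinity enters and Fubini applies
    directly. *)
Definition is_primitive U V := forall a b, a <= b ->
  U b - U a = \int[lam]_(x in `[a, b]) V x.

Definition int_below f x := \int[lam]_(t in `]-oo, x]) f t.

Lemma integrable_on f (D : set (measurableTypeR R)) : measurable D ->
  lam.-integrable setT (EFin \o f) -> lam.-integrable D (EFin \o f).
Proof. by move=> mD; apply: integrableS. Qed.

Lemma integrable_patch f (D : set (measurableTypeR R)) : measurable D ->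
  lam.-integrable setT (EFin \o f) -> lam.-integrable setT (EFin \o (f \_ D)).
Proof.
move=> mD fi; apply: (le_integrable measurableT _ _ fi).
  have /measurable_EFinP mf := measurable_int _ fi.
  apply/measurable_EFinP; apply: (iffLR (measurable_restrictT _ mD)).
  exact: measurable_funTS mf.
by move=> x _; rewrite /= lee_fin patchE; case: ifP; rewrite ?normr0.
Qed.

Lemma is_primitive_int_below f : lam.-integrable setT (EFin \o f) ->
  is_primitive (int_below f) f.
Proof.
move=> fi a b ab; rewrite Rintegral_itvB//.
- by rewrite Rintegral_itv_obnd_cbnd//; exact: integrable_on.
- exact: integrable_on.
Qed.

Lemma lebesgue_measure_cc a b : a <= b -> lam `[a, b]%classic = (b - a)%:E.
Proof.
move=> ab; rewrite lebesgue_measure_itv /= lte_fin; case: ltP => //= ba.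
by have -> : a = b by [apply/eqP; rewrite eq_le ab]; rewrite subrr.
Qed.

Lemma Rintegral_cst_itv a b c : a <= b ->
  \int[lam]_(x in `[a, b]) c = c * (b - a).
Proof.
move=> ab; rewrite Rintegral_cst; last exact: measurable_itv.
by congr (_ * _); exact: (congr1 fine (lebesgue_measure_cc ab)).
Qed.

(** The supremum c of the points satisfying P has such points x within r to its left; one step from
    x passes beyond c, a contradiction unless it ends at b. The step straddles c, as an interval
    does its tag in Cousin's lemma. *)
Lemma real_induction (P : R -> Prop) a b : a <= b -> P a ->
  (forall c, a <= c <= b -> exists2 r, 0 < r & forall x y,
     a <= x -> x <= c -> c <= y -> y <= b -> c - r < x -> y < c + r ->
     P x -> P y) ->
  P b.
Proof.
move=> ab Pa step; pose S := [set x | a <= x <= b /\ P x].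
have Sa : S a by split => //; rewrite lexx.
have supS : has_sup S by split; [exists a|exists b => x [/andP[]]].
pose c := sup S.
have ac : a <= c by apply: sup_upper_bound.
have cb : c <= b by apply: ge_sup; [exists a|move=> x [/andP[]]].
have [r r0 Pr] := step c (introT andP (conj ac cb)).
have [x Sx cx] := sup_adherent r0 supS.
case: (Sx) => /andP[ax xb] Px.
have xc : x <= c by apply: sup_upper_bound.
pose y := Num.min b (c + r / 2).
have cy : c <= y by rewrite le_min cb lerDl divr_ge0 // ltW.
have yb : y <= b by rewrite ge_min lexx.
have yr : y < c + r.
  by apply: (@le_lt_trans _ _ (c + r / 2)); [rewrite ge_min lexx orbT|lra].
have Py : P y := Pr x y ax xc cy yb cx yr Px.
have Sy : S y by split => //; rewrite yb (le_trans ac cy).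
have yc : y <= c by apply: sup_upper_bound.
have : y = b.
  move: yc; rewrite /y; case: (leP b (c + r / 2)) => //.
  by move=> _ h; exfalso; lra.
by move=> <-.
Qed.

(* Cousin's argument: the interval is swept by small steps, each either inside
   O, where the increments of D are charged to U and K, or around a point where
   D has derivative 0. *)
Lemma gauge_estimate (D U N K : R -> R) (O : set R) a b (e : R) : a <= b -> 0 < e ->
  open O ->
  (forall c, ~ O c -> is_derive c (1 : R) D 0) ->
  {homo N : x y / x <= y} -> {homo K : x y / x <= y} ->
  (forall x y, x <= y -> `[x, y]%classic `<=` O ->
     y - x <= N y - N x /\ `|D y - D x| <= `|U y - U x| + (K y - K x)) ->
  exists (n : nat) (p q : nat -> R),
    [/\ forall k, (k < n)%N -> [/\ a <= p k, p k <= q k & q k <= b],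
        forall j k, (j < k)%N -> (k < n)%N -> q j <= p k,
        \sum_(k < n) (q k - p k) <= N b - N a &
        `|D b - D a| <= e * (b - a) + \sum_(k < n) `|U (q k) - U (p k)|
                        + (K b - K a)].
Proof.
move=> ab e0 oO D0 ndN ndK stepO.
pose P x := exists (n : nat) (p q : nat -> R),
    [/\ forall k, (k < n)%N -> [/\ a <= p k, p k <= q k & q k <= x],
        forall j k, (j < k)%N -> (k < n)%N -> q j <= p k,
        \sum_(k < n) (q k - p k) <= N x - N a &
        `|D x - D a| <= e * (x - a) + \sum_(k < n) `|U (q k) - U (p k)|
                        + (K x - K a)].
apply: (@real_induction P a b ab).
  by exists 0%N, (fun=> 0), (fun=> 0); split => //;
    rewrite big_ord0 !subrr ?normr0 ?mulr0 ?addr0.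
move=> c /andP[ac cb].
have [Oc|nOc] := pselect (O c).
  have /nbhs_ballP[r /= r0 rO] : nbhs c O by exact: open_nbhs_nbhs.
  exists r => // x y ax xc cy yb cx yr [n [p [q [h1 h2 h3 h4]]]].
  have xy : x <= y := le_trans xc cy.
  have /(stepO _ _ xy)[hN hD] : `[x, y]%classic `<=` O.
    move=> z /=; rewrite in_itv /= => /andP[xz zy]; apply: rO.
    by rewrite /ball /= ltr_norml; apply/andP; split; lra.
  (* The step lies inside O, so it is appended to the list as interval number n. *)
  exists n.+1, (fun k => if (k < n)%N then p k else x),
    (fun k => if (k < n)%N then q k else y); split.
  - move=> k _; case: ifPn => [/h1[? ? ?]|_]; split => //; lra.
  - move=> j k jk; rewrite ltnS => kn; rewrite (leq_trans jk kn).
    case: ifPn => [kn'|_]; first exact: h2.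
    by have [] := h1 j (leq_trans jk kn).
  - rewrite big_ord_recr /= ltnn; under eq_bigr do rewrite ltn_ord.
    by lra.
  - rewrite big_ord_recr /= ltnn; under eq_bigr do rewrite ltn_ord.
    have := ler_normD (D y - D x) (D x - D a).
    rewrite addrA subrK => h5.
    have : e * (x - a) <= e * (y - a) by rewrite ler_pM2l//; lra.
    lra.
(* The vanishing derivative at c bounds the increment of D over a step x <= c <= y by e (y - x); the
   list of intervals stays as it is. *)
have [r r0 rD] : exists2 r, 0 < r & forall z, `|z - c| < r ->
    `|D z - D c| <= e * `|z - c|.
  have [dD D'] := D0 c nOc.
  have := dD; rewrite /derivable => /cvg_ex[l hl].
  have l0 : l = 0 by rewrite -D'; apply/esym/cvg_lim.
  move: hl; rewrite l0 => /cvgr_dist_lt/(_ e e0)/nbhs_ballP[r /= r0 rh].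
  exists r => // z zr; have [->|zc] := eqVneq z c.
    by rewrite !subrr normr0 mulr0.
  have zb : ball 0 r (z - c) by rewrite -ball_normE /ball_ /= sub0r normrN.
  have := rh _ zb.
  have zc0 : z - c != 0 by rewrite subr_eq0.
  move=> /(_ zc0) /=; rewrite sub0r normrN.
  rewrite /GRing.scale /= mulr1 subrK normrM normfV.
  by rewrite mulrC ltr_pdivrMr ?normr_gt0// => /ltW.
exists r => // x y ax xc cy yb cx yr [n [p [q [h1 h2 h3 h4]]]].
have xy : x <= y := le_trans xc cy.
exists n, p, q; split => //.
- by move=> k /h1[? ? ?]; split => //; lra.
- by have := ndN _ _ xy; lra.
- have hx : `|D x - D c| <= e * `|x - c|.
    by apply: rD; rewrite ltr_norml; apply/andP; split; lra.
  have hy : `|D y - D c| <= e * `|y - c|.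
    by apply: rD; rewrite ltr_norml; apply/andP; split; lra.
  have ex : `|x - c| = c - x by rewrite distrC ger0_norm// subr_ge0.
  have ey : `|y - c| = y - c by rewrite ger0_norm// subr_ge0.
  rewrite ex in hx; rewrite ey in hy.
  have hK := ndK _ _ xy.
  have h5 := ler_normD (D y - D c) (D c - D a).
  have h6 := ler_normD (D c - D x) (D x - D a).
  rewrite addrA subrK in h5; rewrite addrA subrK (distrC (D c) (D x)) in h6.
  have : e * (y - a) = e * (y - c) + e * (c - x) + e * (x - a) by ring.
  lra.
Qed.

Lemma le_int_below f x y : lam.-integrable setT (EFin \o f) ->
  (forall t, 0 <= f t) -> x <= y -> int_below f x <= int_below f y.
Proof.
move=> fi f0 xy; rewrite -subr_ge0 is_primitive_int_below//.
by apply: Rintegral_ge0.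
Qed.

Lemma derive_int_below f : lam.-integrable setT (EFin \o f) ->
  {ae lam, forall x, is_derive x (1 : R) (int_below f) (f x)}.
Proof.
move=> fi; pose P (x : measurableTypeR R) :=
  derivable (int_below f) x 1 /\ derive1 (int_below f) x = f x.
apply: (@ae_imply _ _ _ _ P) => [x [h1 h2]|]; first by split; rewrite -?derive1E.
exact: (@FTC1Ny R f (fun y => integrable_on (measurable_itv _) fi)
  (open_integrable_locally openT fi)).
Qed.

(** The difference D of U and the indefinite integral of V has derivative 0 off a null set A.
    Enclose A in an open W of small measure: on intervals inside W the increments of U and of the
    integral are small by absolute continuity, and elsewhere the derivative is 0. Each of the three
    contributions to |D b - D a| in [gauge_estimate] is at most e / 3. *)
Lemma abs_cont_primitive U V : abs_cont U ->
  {ae lam, forall x, is_derive x (1 : R) U (V x)} ->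
  lam.-integrable setT (EFin \o V) -> is_primitive U V.
Proof.
move=> acU dU iV a b ab.
have dW := derive_int_below iV.
rewrite -(is_primitive_int_below iV ab).
pose D x := U x - int_below V x.
suff : D b - D a = 0 by rewrite /D; lra.
have [A [mA A0 dA]] : {ae lam, forall x, is_derive x (1 : R) D 0}.
  apply: ae_imply2 dU dW => x h1 h2.
  have := is_deriveB h1 h2; rewrite subrr.
  by [].
apply/eqP; rewrite -normr_le0; apply/ler_addgt0Pr => e e0; rewrite add0r.
(* The added 1 keeps the denominator positive when a = b. *)
pose e1 := e / 3 / (b - a + 1).
have e10 : 0 < e1 by rewrite divr_gt0 ?divr_gt0//; lra.
have e3 : 0 < e / 3 by rewrite divr_gt0.
have [d1 d10 acd] := acU a b _ e3.
have [d2 [d20 icd]] := integral_normr_continuous iV e3.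
(* d1 is the modulus for U and d2 the one for the integral of |V|; W will have measure below
   both. *)
pose d := Num.min d1 d2.
have d0 : 0 < d by rewrite lt_min d10 d20.
have [W [oW AW lW]] := @lebesgue_regularity_outer R A d mA
  (eq_ind_r (fun z => (z < +oo)%E) (ltry 0) A0) d0.
have mW : measurable (W : set (measurableTypeR R)) by exact: open_measurable.
have lamW : (lam W < d%:E)%E.
  rewrite -(setDKU AW); apply: le_lt_trans (measureU2 _ _ _) _ => //.
    exact: measurableD.
  by rewrite [X in (_ + X < _)%E]A0 adde0.
(* The primitives of [oneO] and [VO] are the N and K of [gauge_estimate]: the length of W and the
   integral of |V| over W swept so far. *)
pose oneO x : R := \1_W x.
pose VO x : R := `|V x| * \1_W x.
have ioneO : lam.-integrable setT (EFin \o oneO).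
  apply/integrableP; split.
    by apply/measurable_EFinP; exact: measurable_indic.
  under eq_integral do rewrite gee0_abs ?lee_fin//.
  by rewrite integral_indic// setIT (lt_trans lamW)// ltry.
have iVO : lam.-integrable setT (EFin \o VO).
  apply: (le_integrable measurableT _ _ iV).
    apply/measurable_EFinP; apply: measurable_funM; last exact: measurable_indic.
    have /measurable_EFinP mV := measurable_int _ iV.
    exact: measurableT_comp.
  move=> x _; rewrite /= lee_fin normrM normr_id indicE.
  by case: (x \in W); rewrite ?normr1 ?normr0 ?mulr1 ?mulr0.
have VO0 x : 0 <= VO x by rewrite mulr_ge0.
have step x y : x <= y -> `[x, y]%classic `<=` W ->
    y - x <= int_below oneO y - int_below oneO x /\
    `|D y - D x| <= `|U y - U x| + (int_below VO y - int_below VO x).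
  move=> xy xyW; rewrite !is_primitive_int_below//.
  have inO t : t \in `[x, y]%classic -> \1_W t = 1 :> R.
    by rewrite inE => /xyW Wt; rewrite indicE mem_set.
  have ixy := integrable_on (measurable_itv `[x, y]) iV; split.
    have -> : \int[lam]_(t in `[x, y]) oneO t = \int[lam]_(t in `[x, y]) 1.
      by apply: eq_Rintegral => t /inO.
    by rewrite Rintegral_cst_itv// mul1r.
  have -> : D y - D x = (U y - U x) - \int[lam]_(t in `[x, y]) V t.
    by rewrite -(is_primitive_int_below iV xy) /D; ring.
  apply: le_trans (ler_normB _ _) _; rewrite lerD2l.
  apply: le_trans (le_normr_Rintegral _ ixy) _; first exact: measurable_itv.
  rewrite le_eqVlt; apply/orP; left; apply/eqP; apply: eq_Rintegral => t /inO.
  by rewrite /VO => ->; rewrite mulr1.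
have D0 c : ~ W c -> is_derive c (1 : R) D 0.
  by move=> nWc; apply: contrapT => h; exact/nWc/AW/dA.
have [n [p [q [h1 h2 h3 h4]]]] := gauge_estimate ab e10 oW D0
  (fun x y => le_int_below ioneO (fun=> ltac:(by rewrite /oneO)))
  (fun x y => le_int_below iVO VO0) step.
have lamWab : (lam (W `&` `[a, b]) < d%:E)%E.
  apply: le_lt_trans lamW; apply: le_measure; rewrite ?inE//.
  by apply: measurableI => //; exact: measurable_itv.
have hN : int_below oneO b - int_below oneO a < d1.
  rewrite is_primitive_int_below// /Rintegral integral_indic//.
  rewrite -lte_fin fineK; first by rewrite (lt_le_trans lamWab)// lee_fin ge_min lexx.
  by rewrite ge0_fin_numE// (lt_trans lamWab)// ltry.
have hK : int_below VO b - int_below VO a < e / 3.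
  rewrite is_primitive_int_below//.
  have -> : \int[lam]_(x in `[a, b]) VO x =
            \int[lam]_(x in `[a, b] `&` W) `|V x|.
    rewrite Rintegral_mkcondr; apply: eq_Rintegral => x _.
    by rewrite /VO patchE indicE; case: (x \in W); rewrite ?mulr1 ?mulr0.
  apply: icd; first by apply: measurableI => //; exact: measurable_itv.
  by rewrite setIC (lt_le_trans lamWab)// lee_fin ge_min lexx orbT.
have hU : \sum_(k < n) `|U (q k) - U (p k)| < e / 3.
  apply: acd; last exact: le_lt_trans hN.
    by move=> k; have [] := h1 k (ltn_ord k).
  move=> j k jk; have : (j : nat) != k by [].
  rewrite neq_ltn => /orP[jk'|kj]; [left|right]; exact: h2.
have he : e1 * (b - a) <= e / 3.
  rewrite /e1 mulrAC ler_pdivrMr; last lra.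
  by rewrite ler_pM2l//; lra.
by apply: le_trans h4 _; lra.
Qed.

Lemma derive_primitive U V : (forall x, is_derive x (1 : R) U (V x)) ->
  continuous V -> is_primitive U V.
Proof.
move=> dU cV a b; rewrite le_eqVlt => /predU1P[<-|ab].
  by rewrite set_itv1 Rintegral_set1 subrr.
have cU : continuous U.
  by move=> x; apply/differentiable_continuous/derivable1_diffP; case: (dU x).
rewrite /Rintegral (@continuous_FTC2 R V U a b)//.
- exact: continuous_subspaceT.
- split.
  + by move=> x _; case: (dU x).
  + by apply: cvg_at_right_filter; exact: cU.
  + by apply: cvg_at_left_filter; exact: cU.
- by move=> x _; rewrite derive1E; case: (dU x).
Qed.

Section integrable_derivative.
Variables (U V : R -> R).
Hypothesis pUV : is_primitive U V.
Hypothesis iV : lam.-integrable setT (EFin \o V).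

Lemma primitiveE x : U x = U 0 - int_below V 0 + int_below V x.
Proof.
have [x0|/ltW x0] := leP 0 x.
  by have := pUV x0; rewrite -(is_primitive_int_below iV x0); lra.
by have := pUV x0; rewrite -(is_primitive_int_below iV x0); lra.
Qed.

Lemma primitive_le_norm a b : a <= b ->
  `|U b - U a| <= \int[lam]_(x in `[a, b]) `|V x|.
Proof.
move=> ab; rewrite pUV//; apply: le_normr_Rintegral; first exact: measurable_itv.
by apply: integrable_on => //; exact: measurable_itv.
Qed.

Lemma continuous_primitive : continuous U.
Proof.
move=> x; apply/cvgrPdist_lt => e e0.
have [d [d0 icd]] := integral_normr_continuous iV e0.
have small a b : a <= b -> b - a < d -> `|U b - U a| < e.
  move=> ab bad; apply: le_lt_trans (primitive_le_norm ab) _.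
  apply: icd; first exact: measurable_itv.
  by rewrite [ltLHS](lebesgue_measure_cc ab) lte_fin.
apply/nbhs_ballP; exists d => //= y; rewrite /ball /= => xy.
have [yx|/ltW yx] := leP y x.
  by apply: small => //; rewrite ger0_norm// in xy; rewrite subr_ge0.
rewrite distrC; apply: small => //.
by rewrite distrC ger0_norm// in xy; rewrite subr_ge0.
Qed.

Lemma derive_of_primitive : continuous V -> forall x, is_derive x (1 : R) U (V x).
Proof.
move=> cV x.
have -> : U = cst (U 0 - int_below V 0) + int_below V.
  by apply/funext => y; exact: primitiveE.
rewrite -[V x]add0r; apply: is_deriveD.
have xx1 : x < x + 1 by rewrite ltrDl.
have [h1 h2] : derivable (int_below V) x 1 /\ derive1 (int_below V) x = V x.
  exact: (@continuous_FTC1 R V -oo%O x (x + 1) xx1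
    (integrable_on (measurable_itv _) iV) (ltNyr x) (cV x)).
by split; rewrite -?derive1E.
Qed.

Lemma primitive_bounded x : `|U x| <= `|U 0| + \int[lam]_x `|V x|.
Proof.
have h a b : a <= b -> `|U b - U a| <= \int[lam]_x `|V x|.
  move=> ab; apply: le_trans (primitive_le_norm ab) _.
  rewrite Rintegral_mkcond; apply: le_Rintegral => //.
  - apply: integrable_patch; first exact: measurable_itv.
    exact: integrable_norm.
  - exact: integrable_norm.
  - by move=> t _; rewrite patchE; case: ifP => // _; exact: normr_ge0.
rewrite -lerBlDl.
have [x0|/ltW x0] := leP 0 x.
  by apply: le_trans (h _ _ x0); exact: lerB_dist.
by apply: le_trans (h _ _ x0); rewrite distrC; exact: lerB_dist.
Qed.

(** A bounded density makes U Lipschitz; the constant is taken to be [C + 1] so that one can divide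
    by it. *)
Lemma abs_cont_of_bounded (C : R) : (forall x, `|V x| <= C) -> abs_cont U.
Proof.
move=> VC a b e e0.
have C0 : 0 <= C by apply: le_trans (VC 0).
exists (e / (C + 1)); first by rewrite divr_gt0// ltr_wpDl.
move=> n p q pq _ sd.
have Lip x y : x <= y -> `|U y - U x| <= (C + 1) * (y - x).
  move=> xy; apply: le_trans (primitive_le_norm xy) _.
  have -> : (C + 1) * (y - x) = \int[lam]_(t in `[x, y]) (C + 1).
    by rewrite Rintegral_cst_itv.
  apply: le_Rintegral.
  - exact: measurable_itv.
  - apply: integrable_on; first exact: measurable_itv.
    exact: integrable_norm.
  - apply: measurable_bounded_integrable => //.
    + by rewrite [ltLHS](lebesgue_measure_cc xy) ltry.
    + exact: bounded_cst.
  - by move=> t _; rewrite (le_trans (VC t))// lerDl.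
apply: (@le_lt_trans _ _ (\sum_(k < n) (C + 1) * (q k - p k))).
  by apply: ler_sum => k _; apply: Lip; have [_ []] := pq k.
by rewrite -mulr_sumr mulrC -ltr_pdivlMr// ltr_wpDl.
Qed.

End integrable_derivative.

End primitives.

(** * Measures with an integrable density *)

Section density.
Context d (T : measurableType d) (R : realType).
Variables (mu : {sigma_finite_measure set T -> \bar R}) (p : T -> R).
Hypothesis p0 : forall x, 0 <= p x.
Hypothesis ip : mu.-integrable setT (EFin \o p).

Let density (A : set T) := (\int[mu]_(x in A) (p x)%:E)%E.

Let density0 : density set0 = 0%E.
Proof. exact: integral_set0. Qed.

Let density_ge0 A : (0 <= density A)%E.
Proof. by apply: integral_ge0 => x _; rewrite lee_fin. Qed.

Let density_sigma_additive : semi_sigma_additive density.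
Proof.
move=> /= A mA tA mUA; rewrite /density integral_bigcup//=; last first.
  by apply: (integrableS _ _ (subsetT _) ip).
apply: is_cvg_ereal_nneg_natsum_cond => n _ _.
by apply: integral_ge0 => x _; rewrite lee_fin.
Qed.

HB.instance Definition _ := isMeasure.Build _ _ _
  density density0 density_ge0 density_sigma_additive.

Let density_finite : fin_num_fun density.
Proof.
move=> A mA; apply: integrable_fin_num => //.
exact: (integrableS measurableT mA (subsetT _) ip).
Qed.

HB.instance Definition _ := @Measure_isFinite.Build _ _ _ density density_finite.

Lemma density_measure : exists nu : {finite_measure set T -> \bar R},
  forall A, nu A = (\int[mu]_(x in A) (p x)%:E)%E.
Proof. by exists density. Qed.

(** nu is dominated by mu, and its Radon-Nikodym derivative is p almost everywhere because both have
    the same integral over every measurable set. *)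
Lemma integral_density (nu : {finite_measure set T -> \bar R}) (phi : T -> R) M :
  (forall A, measurable A -> nu A = (\int[mu]_(x in A) (p x)%:E)%E) ->
  measurable_fun setT phi -> (forall x, `|phi x| <= M) ->
  (\int[nu]_x (phi x)%:E = \int[mu]_x (phi x * p x)%:E)%E.
Proof.
move=> nuE mphi phiM.
have dom : nu `<< mu.
  apply/null_content_dominatesP => A mA A0; rewrite nuE//.
  apply: null_set_integral => //.
  exact: (measurable_funS measurableT (subsetT A) (measurable_int _ ip)).
rewrite -(Radon_Nikodym_change_of_variables dom)//; last first.
  apply: measurable_bounded_integrable => //.
    by rewrite ltey_eq fin_num_measure.
  by exists M; split => [|N MN x _ /=];
    [exact: num_real|exact: le_trans (phiM x) (ltW MN)].
apply: ae_eq_integral => //.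
- by apply: emeasurable_funM => //; exact/measurable_EFinP.
- apply/measurable_EFinP; apply: measurable_funM => //.
  exact/measurable_EFinP/(measurable_int _ ip).
- under [X in ae_eq _ _ _ X]eq_fun do rewrite EFinM.
  apply: ae_eqe_mul2l; apply: integral_ae_eq => //.
  - exact: Radon_Nikodym_integrable.
  - exact: measurable_int _ ip.
  - move=> A _ mA; rewrite -Radon_Nikodym_integral//.
    exact: nuE.
Qed.

End density.

(** * Stieltjes integrals against a primitive *)

Section stieltjes.
Context {R : realType}.
Local Notation lam := (@lebesgue_measure R).

Lemma lebesgue_stieltjes_oc (F : cumulative R R) (a b : R) : a <= b ->
  lebesgue_stieltjes_measure F `]a, b]%classic = (F b - F a)%:E.
Proof.
move=> ab; rewrite /lebesgue_stieltjes_measure /= /measure_extension /=.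
rewrite measurable_mu_extE; last exact: is_ocitv.
exact: (wlength_itv_bnd F false false ab).
Qed.

(** Since F is a primitive of p, the Stieltjes measure of F and the measure with density p agree on
    the intervals []a, b]], hence on all Borel sets. *)
Lemma cint_stieltjes (F : cumulative R R) (p : R -> R) (phi : R -> R[i]) M :
  (forall x, 0 <= p x) -> lam.-integrable setT (EFin \o p) ->
  is_primitive F p -> @cmeasurable _ (measurableTypeR R) R phi ->
  (forall x, norm1 (phi x) <= M) ->
  cint (lebesgue_stieltjes_measure F) phi = cint lam (fun x => phi x * (p x)%:C).
Proof.
move=> p0 ip Fp [m1 m2] phiM.
have [nu nuE] := @density_measure _ (measurableTypeR R) R lam p p0 ip.
have LS A : measurable A -> lebesgue_stieltjes_measure F A = nu A.
  apply: lebesgue_stieltjes_measure_unique => _ [[a b]] _ <- /=.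
  have [ab|ba] := leP a b; last first.
    by rewrite set_itv_ge -?leNgt ?bnd_simp ?(ltW ba)// !measure0.
  rewrite lebesgue_stieltjes_oc// nuE integral_itv_obnd_cbnd; last first.
    exact: (measurable_funS measurableT (subsetT _) (measurable_int _ ip)).
  rewrite Fp// fineK//; apply: integrable_fin_num; first exact: measurable_itv.
  by apply: integrable_on => //; exact: measurable_itv.
have phi1 x : `|re_part phi x| <= M.
  by apply: le_trans (phiM x); rewrite lerDl.
have phi2 x : `|im_part phi x| <= M.
  by apply: le_trans (phiM x); rewrite lerDr.
have aux (f : measurableTypeR R -> R) : measurable_fun setT f ->
      (forall x, `|f x| <= M) ->
    \int[lebesgue_stieltjes_measure F]_x f x = \int[lam]_x (f x * p x).
  move=> mf fM; rewrite /Rintegral; congr fine.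
  rewrite -(@integral_density _ (measurableTypeR R) R lam p ip nu f M)//.
  by apply: eq_measure_integral => A mA _; exact: LS.
rewrite /cint /cintegral !aux//; congr (_ +i* _); apply: eq_Rintegral => x _;
  by rewrite /re_part /im_part; case: (phi x) => u v /=; rewrite mulr0 ?subr0 ?add0r.
Qed.

Section of_primitive.
Variables (V w : R -> R).
Hypothesis pVw : is_primitive V w.
Hypothesis iw : lam.-integrable setT (EFin \o w).

(* Not the positive and negative parts of w: any two nonnegative integrable
   functions with difference w will do. *)
Let p x := `|w x|.
Let q x := `|w x| - w x.

Let ip : lam.-integrable setT (EFin \o p).
Proof. exact: integrable_norm. Qed.

Let iq : lam.-integrable setT (EFin \o q).
Proof. exact: (integrableB measurableT ip iw). Qed.

Let p0 x : 0 <= p x. Proof. exact: normr_ge0. Qed.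
Let q0 x : 0 <= q x. Proof. by rewrite subr_ge0 ler_norm. Qed.

(** The constant of integration in [primitiveE], absorbed into F. *)
Let c := V 0 - int_below w 0.
Let F x := c + int_below p x.
Let G := int_below q.

Let pF : is_primitive F p.
Proof.
by move=> a b ab; rewrite -(is_primitive_int_below ip ab) /F; ring.
Qed.

Let pG : is_primitive G q. Proof. exact: is_primitive_int_below. Qed.

Let VE x : V x = F x - G x.
Proof.
suff -> : V x = c + (int_below p x - int_below q x) by rewrite addrA.
rewrite (primitiveE pVw iw) /c /int_below -RintegralB.
- by congr (_ + _); apply: eq_Rintegral => t _; rewrite /q subKr.
- exact: measurable_itv.
- exact: integrable_on (measurable_itv _) ip.
- exact: integrable_on (measurable_itv _) iq.
Qed.

Let nd (U u : R -> R) : is_primitive U u -> (forall x, 0 <= u x) ->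
  {homo U : x y / x <= y}.
Proof.
by move=> pU u0 x y xy; rewrite -subr_ge0 pU//; apply: Rintegral_ge0.
Qed.

Let bnd (U u : R -> R) : is_primitive U u ->
  lam.-integrable setT (EFin \o u) -> bounded_fun U.
Proof.
move=> pU iu; exists (`|U 0| + \int[lam]_x `|u x|); split; first exact: num_real.
move=> N MN x _ /=; apply: le_trans (ltW MN); exact: primitive_bounded.
Qed.

(** V = F - G with both terms monotone and bounded; the variation of each on [a, b] is its
    increment, at most twice its bound. *)
Lemma bounded_var_primitive : bounded_var V.
Proof.
exists ((`|F 0| + \int[lam]_x `|p x|) *+ 2 + (`|G 0| + \int[lam]_x `|q x|) *+ 2).
move=> a b ab.
have -> : V = (F \+ (\- G))%R by apply/funext => x; exact: VE.
apply: le_trans (total_variation_le _ _ ab) _.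
rewrite total_variationN !nondecreasing_total_variation//; last 2 first.
- by move=> x y _ _ xy; apply: (nd pG q0).
- by move=> x y _ _ xy; apply: (nd pF p0).
rewrite -EFinD lee_fin; apply: lerD; apply: le_trans (ler_norm _) _;
  apply: le_trans (ler_normB _ _) _; rewrite mulr2n; apply: lerD;
  exact: primitive_bounded.
Qed.

(** F and G are the two integrators; their densities differ by p - q = w. *)
Lemma stieltjesR_primitive (phi : R -> R[i]) M :
  @cmeasurable _ (measurableTypeR R) R phi ->
  (forall x, norm1 (phi x) <= M) ->
  is_stieltjesR phi V (cint lam (fun x => phi x * (w x)%:C)).
Proof.
move=> mphi phiM.
pose F' : cumulative R R := HB.pack F (isCumulative.Build R _ R F
  (nd pF p0) (right_continuousW (continuous_primitive pF ip))).
pose G' : cumulative R R := HB.pack G (isCumulative.Build R _ R G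
  (nd pG q0) (right_continuousW (continuous_primitive pG iq))).
exists F', G'; split.
- exact: bnd pF ip.
- exact: bnd pG iq.
- exact: VE.
- rewrite -!/(cint _ _) (cint_stieltjes (F := F') p0 ip pF mphi phiM).
  rewrite (cint_stieltjes (F := G') q0 iq pG mphi phiM).
  have ci (u : R -> R) : lam.-integrable setT (EFin \o u) ->
      cintegrable lam (fun x : measurableTypeR R => phi x * (u x)%:C).
    move=> iu; have icu : cintegrable lam (fun x : measurableTypeR R => (u x)%:C : R[i]).
      split => //; rewrite (_ : _ \o _ = cst 0%E)//; exact: integrable0.
    have := cintegrableM_bounded icu mphi phiM.
    by congr (cintegrable _ _); apply/funext => x; rewrite mulrC.
  rewrite -[X in _ - X]mul1r -mulNr -cintZ; last exact: ci.
  rewrite -cintD; [|exact: ci|apply: cintegrableZ; exact: ci].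
  apply: eq_cint => x; rewrite mulN1r -mulrBr -rmorphB /=.
  by rewrite /p /q subKr.
Qed.

End of_primitive.

End stieltjes.

(** * Primitives under convolution, and the transform of a derivative *)

Section complex_primitives.
Context {R : realType}.
Local Notation lam := (@lebesgue_measure R).
Implicit Types g h k : R -> R[i].

Definition is_cprimitive (U V : R -> R[i]) :=
  is_primitive (re_part U) (re_part V) /\ is_primitive (im_part U) (im_part V).

Lemma is_cprimitiveP (U V : R -> R[i]) : is_cprimitive U V <->
  forall a b, a <= b -> U b - U a = cintegral lam `[a, b] V.
Proof.
split=> [[U1 U2] a b ab|UV].
  rewrite /cintegral -U1// -U2// /re_part /im_part.
  by case: (U a) (U b) => ? ? [].
by split => a b ab; have := UV a b ab; rewrite /re_part /im_part;
  case: (U a) (U b) => ? ? [? ?] [].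
Qed.

Lemma cint_indic_itv (V : R -> R[i]) (a b : R) :
  cint lam (fun x => (\1_`[a, b] x)%:C * V x) = cintegral lam `[a, b] V.
Proof. by rewrite cintegral_mkcond. Qed.

Let cmeasurable_indic (A : set (measurableTypeR R)) : measurable A ->
  cmeasurable (fun x : measurableTypeR R => (\1_A x)%:C : R[i]).
Proof.
by move=> mA; split; [exact: measurable_indic|exact: measurable_cst].
Qed.

Let norm1_indic (A : set R) (x : R) : norm1 ((\1_A x)%:C : R[i]) <= 1.
Proof.
by rewrite /norm1 /= normr0 addr0 indicE; case: (x \in A); rewrite ?normr1 ?normr0.
Qed.

Section primitive_bound.
Variables (h h1 : R -> R[i]).
Hypothesis hh1 : is_cprimitive h h1.
Hypothesis ih1 : cintegrable lam h1.

Lemma continuous_cprimitive :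
  on_parts (fun w : R -> R => continuous w) h.
Proof.
by case: hh1 ih1 => p1 p2 [i1 i2]; split;
  [exact: continuous_primitive p1 i1|exact: continuous_primitive p2 i2].
Qed.

Lemma cprimitive_bounded : exists M, forall x, norm1 (h x) <= M.
Proof.
case: hh1 ih1 => p1 p2 [i1 i2].
exists ((`|re_part h 0| + \int[lam]_x `|re_part h1 x|) +
  (`|im_part h 0| + \int[lam]_x `|im_part h1 x|)) => x.
by apply: lerD; [exact: primitive_bounded p1 i1 x|exact: primitive_bounded p2 i2 x].
Qed.

(** Take the indicator of [a, b] as weight in [cint_convolution]: the inner integral of h1 over
    [a - s, b - s] is an increment of h. As h is bounded, the integral defining [convolution g h]
    converges at every point, in particular at a and b. *)
Lemma cprimitive_convolution g : cintegrable lam g ->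
  is_cprimitive (convolution g h) (convolution g h1).
Proof.
move=> ig; apply/is_cprimitiveP => a b ab.
have [M hM] := cprimitive_bounded.
have ish x : cintegrable lam (fun s : measurableTypeR R => g s * h (x - s)).
  apply: (cintegrableM_bounded ig) => [|s]; last exact: hM.
  have [c1 c2] := continuous_cprimitive.
  have msub : measurable_fun setT (fun s : measurableTypeR R => x - s).
    by apply: measurable_funB.
  split.
    apply: (@measurableT_comp _ _ _ _ _ _ (re_part h)) => //.
    by apply: continuous_measurable_fun.
  apply: (@measurableT_comp _ _ _ _ _ _ (im_part h)) => //.
  by apply: continuous_measurable_fun.
rewrite -cint_indic_itv (cint_convolution (M := 1) _ _ ig ih1); last 2 first.
- by apply: cmeasurable_indic; exact: measurable_itv.
- by move=> x; exact: norm1_indic.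
rewrite /convolution -!/(cint lam _) -[X in _ - X]mul1r -mulNr -cintZ//.
rewrite -cintD//; last by apply: cintegrableZ.
apply: eq_cint => s; rewrite mulN1r -mulrBr; congr (_ * _).
have mF : cmeasurable (fun y : measurableTypeR R =>
    (\1_`[a - s, b - s] y)%:C * h1 y).
  apply: cmeasurableM; last exact: (cintegrable_measurable ih1).
  by apply: cmeasurable_indic; exact: measurable_itv.
have -> : cint lam (fun x => (\1_`[a, b] x)%:C * h1 (x - s)) =
          cint lam (fun y => (\1_`[a - s, b - s] y)%:C * h1 y).
  rewrite -(cint_shift s mF); apply: eq_cint => x; congr (_%:C * _).
  by rewrite !indicE !mem_setE !in_itv /= !lerD2r.
by rewrite cint_indic_itv -((is_cprimitiveP _ _).1 hh1)// lerD2r.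
Qed.

End primitive_bound.

Section fourier_derivative.
Variables (h h1 : R -> R[i]).
Hypothesis hh1 : is_cprimitive h h1.
Hypothesis ih : cintegrable lam h.
Hypothesis ih1 : cintegrable lam h1.

Let chi (a x : R) : R[i] := (\1_`[- a, 0] x)%:C.

Let ichi a : cintegrable lam (chi a).
Proof.
split; first exact: integrable_indic_itv.
by rewrite (_ : _ \o _ = cst 0%E)//; exact: integrable0.
Qed.

Let convolution_chi (a x : R) : 0 <= a -> convolution h1 (chi a) x = h (x + a) - h x.
Proof.
move=> a0; rewrite ((is_cprimitiveP _ _).1 hh1); last by rewrite lerDl.
rewrite -cint_indic_itv; apply: eq_cint => s; rewrite mulrC; congr (_%:C * _).
rewrite !indicE !mem_setE !in_itv /= lerBrDr subr_le0 addrC lerBlDr.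
by rewrite andbC addrC.
Qed.

Let half_turn (t : R) : t != 0 ->
  cos (t * (pi / `|t|)) = -1 /\ sin (t * (pi / `|t|)) = 0.
Proof.
move=> t0; case: (ltrgt0P t) => ht; last by rewrite ht eqxx in t0.
  have -> : t * (pi / t) = pi by field.
  by rewrite cospi sinpi.
have -> : t * (pi / - t) = - pi by field.
by rewrite cosN sinN cospi sinpi oppr0.
Qed.

(** This is (exp(i t a) - 1) / (i t) with exp(i t a) = -1. *)
Let fourier_chi (t : R) : t != 0 -> fourier (chi (pi / `|t|)) t = 0 +i* (2 / t).
Proof.
move=> t0; set a := pi / `|t|.
have a0 : - a <= 0 by rewrite oppr_le0 divr_ge0 ?pi_ge0.
have ta : cos (t * a) = -1 /\ sin (t * a) = 0 := half_turn t0.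
have pc : is_primitive (fun s => sin (t * s) / t) (fun s => cos (t * s)).
  apply: derive_primitive => [x|].
    by apply: is_derive_eq; rewrite /GRing.scale /=; field.
  by move=> x; apply: continuous_comp; [exact: mulrl_continuous|exact: continuous_cos].
have ps : is_primitive (fun s => - (cos (t * s) / t)) (fun s => sin (t * s)).
  apply: derive_primitive => [x|].
    by apply: is_derive_eq; rewrite /GRing.scale /=; field.
  by move=> x; apply: continuous_comp; [exact: mulrl_continuous|exact: continuous_sin].
have -> : fourier (chi a) t = cintegral lam `[- a, 0] (fun s => expmi (t * s)).
  by rewrite -cint_indic_itv; apply: eq_cint => s; rewrite mulrC.
rewrite /cintegral; congr (_ +i* _).
  have := pc _ _ a0; rewrite mulr0 sin0 mul0r mulrN sinN ta.2 oppr0 mul0r subrr.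
  by move=> {2}->.
rewrite (_ : im_part _ = fun s => -1 * sin (t * s)); last first.
  by apply/funext => s; rewrite mulN1r.
rewrite RintegralZl; last 2 first.
- exact: measurable_itv.
- apply: continuous_compact_integrable; first exact: segment_compact.
  apply: continuous_subspaceT => x.
  by apply: continuous_comp; [exact: mulrl_continuous|exact: continuous_sin].
by rewrite -ps// mulr0 cos0 mulrN cosN ta.1; field.
Qed.

(* The increment h (x + a) - h x is the convolution of h1 with the indicator of
   [-a, 0]; the choice a = pi / |t| gives expmi (- (t * a)) = -1, so that the
   transforms can be compared without a limiting argument. *)
Lemma fourier_derivative (t : R) : t != 0 ->
  fourier h1 t = (0 +i* t) * fourier h t.
Proof.
move=> t0; have a0 : 0 <= pi / `|t| :> R by rewrite divr_ge0 ?pi_ge0.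
have := fourier_convolution t ih1 (ichi (pi / `|t|)).
rewrite fourier_chi//.
set a := pi / `|t| in a0 *.
have mh := cintegrable_measurable ih.
have eta : expmi (t * - a) = -1 :> R[i].
  have [ca sa] := half_turn t0.
  by rewrite /expmi mulrN cosN sinN ca sa !oppr0; apply/eqP;
    rewrite eq_complex /= oppr0 !eqxx.
have mF : cmeasurable (fun y : measurableTypeR R => expmi (t * (y - a)) * h y).
  apply: cmeasurableM => //; apply: cmeasurable_expmi.
  by apply: measurable_funM => //; apply: measurable_funB.
(* Translation by half a period only changes the sign of the transform. *)
have iha : cint lam (fun x => expmi (t * x) * h (x + a)) = - fourier h t.
  have -> : cint lam (fun x => expmi (t * x) * h (x + a)) =
            cint lam (fun y => expmi (t * (y - a)) * h y).
    by rewrite -(cint_shift (- a) mF); apply: eq_cint => x; rewrite opprK addrK.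
  rewrite -[RHS]mulN1r -eta -cintZ; last exact: cintegrable_fourier_integrand.
  by apply: eq_cint => x; rewrite mulrDr expmiD; ring.
have -> : fourier (convolution h1 (chi a)) t = - fourier h t - fourier h t.
  rewrite -{1}iha -[X in _ - X]mul1r -mulNr -cintZ; last first.
    exact: cintegrable_fourier_integrand.
  rewrite -cintD.
  - by apply: eq_cint => x; rewrite convolution_chi//; ring.
  - have := cintegrable_fourier_integrand t (cintegrable_convolution ih1 (ichi a)).
    move=> /(cintegrableD (cintegrable_fourier_integrand t ih)).
    congr (cintegrable _ _); apply/funext => x; rewrite convolution_chi//.
    by rewrite mulrBr addrC subrK.
  - by apply: cintegrableZ; exact: cintegrable_fourier_integrand.
(* The relation reached is -2 \hat h = (2i / t) \hat h1 at t; it is solved for real and imaginary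
   parts. *)
case: (fourier h t) => x y; case: (fourier h1 t) => x1 y1.
move=> /eqP; rewrite eq_complex /= => /andP[/eqP e1 /eqP e2].
have h1' : x1 = - (t * y).
  have : x1 * (2 / t) = - y - y by lra.
  move=> e; have -> : x1 = (x1 * (2 / t)) * t / 2 by field.
  by rewrite e; field.
have h2' : y1 = t * x.
  have : y1 * (2 / t) = x + x by lra.
  move=> e; have -> : y1 = (y1 * (2 / t)) * t / 2 by field.
  by rewrite e; field.
by apply/eqP; rewrite eq_complex /= h1' h2'; apply/andP; split; apply/eqP; ring.
Qed.

End fourier_derivative.

End complex_primitives.

(** * A representative of f bounded at every point *)

Section bounded_representative.
Context {R : realType}.
Local Notation lam := (@lebesgue_measure R).

Lemma lebesgue_measure_setT_gt0 : (0 < lam setT)%E.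
Proof.
apply: (@lt_le_trans _ _ (lam `[0, 1]%classic)).
  by rewrite [ltRHS](lebesgue_measure_cc ler01) subr0 lte01.
by apply: le_measure; rewrite ?inE//; exact: measurable_itv.
Qed.

Lemma Linfty_representative (f : R -> R[i]) : Linfty f ->
  @cmeasurable _ (measurableTypeR R) R f /\
  exists (f' : R -> R[i]) M,
    [/\ @cmeasurable _ (measurableTypeR R) R f', forall x, norm1 (f' x) <= M &
        {ae lam, forall x, f x = f' x}].
Proof.
move=> [/(Linfty_ae_bounded lebesgue_measure_setT_gt0)[m1 [M1 b1]]].
move=> /(Linfty_ae_bounded lebesgue_measure_setT_gt0)[m2 [M2 b2]].
split; first by split.
pose A : set (measurableTypeR R) :=
  [set x | `|re_part f x| <= M1] `&` [set x | `|im_part f x| <= M2].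
have mle (u : measurableTypeR R -> R) M : measurable_fun setT u ->
    measurable [set x | `|u x| <= M].
  move=> mu; have mnu : measurable_fun setT (fun x => `|u x|).
    exact: measurableT_comp.
  rewrite -[X in measurable X]setTI.
  have -> : [set x | `|u x| <= M] = (fun x => `|u x|) @^-1` `]-oo, M].
    by apply/seteqP; split => x /=; rewrite in_itv.
  by apply: mnu => //; exact: measurable_itv.
have mA : measurable A by apply: measurableI; exact: mle.
(* The maximum with 0 covers the points outside A, where the representative vanishes. *)
exists (fun x => (\1_A x)%:C * f x), (Num.max 0 (M1 + M2)); split.
- apply: cmeasurableM; last by split.
  by split; [exact: measurable_indic|exact: measurable_cst].
- move=> x; rewrite indicE le_max; have [xA|xA] := boolP (x \in A); last first.
    by rewrite mul0r /norm1 /= normr0 addr0 lexx.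
  move: xA; rewrite inE => -[/= h1 h2]; rewrite mul1r.
  by apply/orP; right; apply: lerD.
- apply: ae_imply2 b1 b2 => x h1 h2.
  by rewrite indicE mem_set// mul1r.
Qed.

End bounded_representative.

(** * The two integrable parts of f *)

Section truncations.
Context {R : realType}.
Local Notation lam := (@lebesgue_measure R).
Variables (f f' : R -> R[i]) (M : R).
Hypothesis mf : @cmeasurable _ (measurableTypeR R) R f.
Hypothesis mf' : @cmeasurable _ (measurableTypeR R) R f'.
Hypothesis f'M : forall x, norm1 (f' x) <= M.
Hypothesis ff' : {ae lam, forall x, f x = f' x}.

Let far : set (measurableTypeR R) := [set t | 1 < `|t|].

Definition inner_part (t : R) : R[i] := (\1_`[-1, 1] t)%:C * f' t.
Definition outer_part (t : R) : R[i] := (\1_far t)%:C * (f' t / (t ^+ 2)%:C).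

Let mfar : measurable far.
Proof.
have mn : measurable_fun setT (fun x : measurableTypeR R => `|x| : R).
  by apply: continuous_measurable_fun; exact: norm_continuous.
rewrite -[X in measurable X]setTI.
have -> : far = (fun x => `|x|) @^-1` `]1, +oo[.
  by apply/seteqP; split => x /=; rewrite in_itv /= andbT.
by apply: mn => //; exact: measurable_itv.
Qed.

Let cmeasurable_real (u : measurableTypeR R -> R) : measurable_fun setT u ->
  cmeasurable (fun x : measurableTypeR R => (u x)%:C : R[i]).
Proof. by move=> mu; split => //; exact: measurable_cst. Qed.

Let invr_real (x : R) : ((x%:C)^-1 : R[i]) = (x^-1)%:C.
Proof. by rewrite -fmorphV. Qed.

(** Inversion is discontinuous at 0; the real power of exponent -1 is measurable and agrees with it
    on all nonnegative reals, 0 included. *)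
Let measurable_sqrV :
  measurable_fun setT (fun x : measurableTypeR R => (x ^+ 2)^-1 : R).
Proof.
apply: (eq_measurable_fun (fun x : R => (x ^+ 2) `^ (-1))).
  by move=> x _; rewrite powR_inv1// sqr_ge0.
apply: (@measurableT_comp _ _ _ _ _ _ (fun y : R => y `^ (-1))).
  exact: measurable_powR.
by apply: measurable_funX.
Qed.

Let cmeasurable_div (u : R -> R[i]) : @cmeasurable _ (measurableTypeR R) R u ->
  @cmeasurable _ (measurableTypeR R) R (fun t => u t / (t ^+ 2)%:C).
Proof.
move=> mu; have := cmeasurableM mu (cmeasurable_real measurable_sqrV).
by congr (cmeasurable _); apply/funext => x; rewrite -invr_real.
Qed.

Let cmeasurable_indic (A : set (measurableTypeR R)) : measurable A ->
  cmeasurable (fun x : measurableTypeR R => (\1_A x)%:C : R[i]).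
Proof. by move=> mA; apply: cmeasurable_real; exact: measurable_indic. Qed.

Let norm1_real (x : R) : norm1 (x%:C) = `|x|.
Proof. by rewrite /norm1 /= normr0 addr0. Qed.

(** One majorant for both parts: 1 + x^2 <= 2 when |x| <= 1, and 1 / x^2 <= 2 / (1 + x^2) when |x| >
    1. *)
Let integrable_bound : lam.-integrable setT
  (EFin \o (fun x : R => (2 * M) * (1 + x ^+ 2)^-1)).
Proof. exact: (integrableZl measurableT (2 * M) integrable_oneDsqrV). Qed.

Let M0 : 0 <= M. Proof. exact: le_trans (norm1_ge0 _) (f'M 0). Qed.

Lemma cintegrable_inner : cintegrable lam inner_part.
Proof.
apply: (le_cintegrable _ _ integrable_bound).
  by apply: cmeasurableM => //; apply: cmeasurable_indic; exact: measurable_itv.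
move=> x; apply: le_trans (norm1M _ _) _; rewrite norm1_real indicE.
have p1 : 0 < 1 + x ^+ 2 by rewrite ltr_pwDl// sqr_ge0.
have [xi|_] := boolP (x \in `[-1, 1]%classic); last first.
  by rewrite normr0 mul0r mulr_ge0 ?invr_ge0 ?mulr_ge0// ltW.
move: xi; rewrite inE /= in_itv /= => /andP[x1 x2].
rewrite normr1 mul1r; apply: le_trans (f'M x) _.
rewrite ler_pdivlMr// (mulrC 2) ler_wpM2l//.
have : `|x| ^+ 2 <= 1 by rewrite expr_le1// ler_norml x1.
by rewrite real_normK ?num_real//; lra.
Qed.

Lemma cintegrable_outer : cintegrable lam outer_part.
Proof.
apply: (le_cintegrable _ _ integrable_bound).
  by apply: cmeasurableM; [exact: cmeasurable_indic|exact: cmeasurable_div].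
move=> x; apply: le_trans (norm1M _ _) _; rewrite norm1_real indicE.
have p1 : 0 < 1 + x ^+ 2 by rewrite ltr_pwDl// sqr_ge0.
have [xf|_] := boolP (x \in far); last first.
  by rewrite normr0 mul0r mulr_ge0 ?invr_ge0 ?mulr_ge0// ltW.
move: xf; rewrite inE /far /= => x1.
have x2 : 1 < x ^+ 2 by rewrite -[x ^+ 2]real_normK ?num_real// exprn_egt1.
have x20 : 0 < x ^+ 2 by lra.
rewrite normr1 mul1r; apply: le_trans (norm1M _ _) _.
rewrite invr_real norm1_real ger0_norm ?invr_ge0 ?sqr_ge0//.
apply: (@le_trans _ _ (M * (x ^+ 2)^-1)); first by rewrite ler_wpM2r ?invr_ge0 ?sqr_ge0.
rewrite (mulrC 2) -mulrA ler_wpM2l// ler_pdivlMr// mulrC ler_pdivrMr//.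
lra.
Qed.

Lemma fourier1E s : fourier1 f s = fourier inner_part s.
Proof.
rewrite /fourier1 cintegral_mkcond; apply: ae_eq_cint.
- apply: cmeasurableM; first by apply: cmeasurable_indic; exact: measurable_itv.
  by apply: cmeasurableM => //; apply: cmeasurable_expmi; apply: measurable_funM.
- exact/cintegrable_measurable/cintegrable_fourier_integrand/cintegrable_inner.
- by apply: ae_imply ff' => x ->; rewrite /inner_part mulrCA.
Qed.

Lemma PsiE s : Psi f s = fourier outer_part s.
Proof.
rewrite /Psi cintegral_mkcond; apply: ae_eq_cint.
- apply: cmeasurableM; first exact: cmeasurable_indic.
  apply: cmeasurable_div.
  by apply: cmeasurableM => //; apply: cmeasurable_expmi; apply: measurable_funM.
- exact/cintegrable_measurable/cintegrable_fourier_integrand/cintegrable_outer.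
- by apply: ae_imply ff' => x ->; rewrite /outer_part -mulrA mulrCA.
Qed.

Lemma inner_outer (x : R) :
  inner_part x + outer_part x * (x ^+ 2)%:C = f' x.
Proof.
rewrite /inner_part /outer_part !indicE mem_setE in_itv /= -ler_norml.
have [x1|x1] := leP `|x| 1.
  rewrite memNset ?mul0r ?mul1r ?addr0// /far /=.
  by apply/negP; rewrite -leNgt.
rewrite mem_set// mul0r mul1r add0r mulfVK//.
have x0 : x != 0 by rewrite -normr_gt0; apply: lt_trans x1.
by rewrite eq_complex /= eqxx andbT expf_neq0.
Qed.

End truncations.

(* h1 is h', and h2 is h'' (which exists almost everywhere). *)
Theorem theorem7p2 (R : realType) (f g h h1 h2 : R -> R[i])
  (f_Linfty : Linfty f)
  (g_L1 : L1 g)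
  (h_deriv : forall x : R, has_deriv h x (h1 x))
  (h1_cont : on_parts (fun w : R -> R => continuous w) h1)
  (h1_ac : on_parts (@abs_cont R) h1)
  (h1_deriv : {ae @lebesgue_measure R, forall x : R, has_deriv h1 x (h2 x)})
  (h_L1 : L1 h) (h1_L1 : L1 h1) (h2_L1 : L1 h2) :
  is_distr_integral f (convolution g h)
    (cintegral (@lebesgue_measure R) setT
       (fun t => f t * fourier g t * fourier h t)).
Proof.
pose lam := @lebesgue_measure R.
have L1P (u : R -> R[i]) : L1 u <-> cintegrable lam u.
  by split => -[u1 u2]; split; apply/Lfun1_integrable.
have ig := (L1P _).1 g_L1; have ih := (L1P _).1 h_L1.
have ih1 := (L1P _).1 h1_L1; have ih2 := (L1P _).1 h2_L1.
have pr1 : is_cprimitive h h1.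
  by case: h1_cont => c1 c2; split; apply: derive_primitive => // x;
    case: (h_deriv x).
have pr2 : is_cprimitive h1 h2.
  case: h1_ac ih2 => a1 a2 [i1 i2]; split; apply: abs_cont_primitive => //.
    by apply: ae_imply h1_deriv => x [].
  by apply: ae_imply h1_deriv => x [].
set u := convolution g h; pose v := convolution g h1; pose w := convolution g h2.
have iu : cintegrable lam u by exact: cintegrable_convolution.
have iv : cintegrable lam v by exact: cintegrable_convolution.
have iw : cintegrable lam w by exact: cintegrable_convolution.
have puv : is_cprimitive u v by exact: cprimitive_convolution.
have pvw : is_cprimitive v w by exact: cprimitive_convolution.
have [mf [f' [M [mf' f'M ff']]]] := Linfty_representative f_Linfty.
pose k1 := inner_part f'; pose k2 := outer_part f'.
have ik1 : cintegrable lam k1 := cintegrable_inner mf' f'M.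
have ik2 : cintegrable lam k2 := cintegrable_outer mf' f'M.
have E1 : fourier1 f = fourier k1.
  by apply/funext => s; exact: (fourier1E mf mf' f'M ff').
have E2 : Psi f = fourier k2.
  by apply/funext => s; exact: (PsiE mf mf' f'M ff').
have mk2 : cmeasurable (fourier k2) := cmeasurable_fourier ik2.
split; first exact/L1P; split.
  (* v is bounded as a primitive of the integrable w, so u is Lipschitz. *)
  case: puv pvw iv iw => p1 p2 [q1 q2] [i1 i2] [j1 j2]; split.
    exact: (abs_cont_of_bounded p1 i1 (primitive_bounded q1 j1)).
  exact: (abs_cont_of_bounded p2 i2 (primitive_bounded q2 j2)).
exists v; split.
(* v is continuous, so u is differentiable everywhere. *)
- apply: ae_all => x.
  case: puv iv (continuous_cprimitive pvw iw) => p1 p2 [i1 i2] [c1 c2].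
  split; first exact: (derive_of_primitive p1 i1 c1).
  exact: (derive_of_primitive p2 i2 c2).
- by case: (continuous_cprimitive pvw iw) => c1 c2; split; exact: right_continuousW.
- case: pvw iw => p1 p2 [i1 i2]; split.
    exact: bounded_var_primitive p1 i1.
  exact: bounded_var_primitive p2 i2.
exists (cint lam (fun s => fourier k2 s * w s)).
  rewrite E2; case: pvw iw => p1 p2 [i1 i2].
  exists (cint lam (fun s => fourier k2 s * (re_part w s)%:C)),
    (cint lam (fun s => fourier k2 s * (im_part w s)%:C)); split.
  - exact: (stieltjesR_primitive p1 i1 mk2 (fun s => norm1_fourier s ik2)).
  - exact: (stieltjesR_primitive p2 i2 mk2 (fun s => norm1_fourier s ik2)).
  - have ci (q : R -> R) : lam.-integrable setT (EFin \o q) ->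
        cintegrable lam (fun x : measurableTypeR R => fourier k2 x * (q x)%:C).
      move=> iq; apply: cintegrable_fourierM => //; split => //.
      by rewrite (_ : _ \o _ = cst 0%E)//; exact: integrable0.
    rewrite -cintZ; last exact: ci.
    rewrite -cintD; [|exact: ci|by apply: cintegrableZ; exact: ci].
    apply: eq_cint => s; rewrite mulrCA -mulrDr; congr (_ * _).
    rewrite /re_part /im_part; case: (w s) => a b.
    by apply/eqP; rewrite eq_complex /=; apply/andP; split; apply/eqP; ring.
rewrite E1 -!/(cint lam _) !cint_fourierM//.
have iM (k q : R -> R[i]) : cintegrable lam k -> cintegrable lam q ->
    cintegrable lam (fun t : measurableTypeR R => k t * fourier q t).
  move=> ik iq; apply: (cintegrableM_bounded ik (cmeasurable_fourier iq)) => t.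
  exact: norm1_fourier iq.
rewrite -[X in _ - X]mul1r -mulNr -cintZ; last exact: iM.
rewrite -cintD; [|exact: iM|by apply: cintegrableZ; exact: iM].
have mfou : cmeasurable (fun t : measurableTypeR R => fourier g t * fourier h t).
  by apply: cmeasurableM; exact: cmeasurable_fourier.
transitivity (cint lam (fun t => f' t * (fourier g t * fourier h t))).
  apply: ae_eq_cint.
  - by rewrite (_ : (fun t => _) = fun t => f t * (fourier g t * fourier h t));
      [exact: cmeasurableM|apply/funext => t; rewrite mulrA].
  - exact: cmeasurableM.
  - by apply: ae_imply ff' => t ->; rewrite mulrA.
apply: eq_cint => t; rewrite !fourier_convolution//.
(* Two derivatives give the factor (i t)^2 = - t^2 for nonzero t; at t = 0 both sides vanish with
   k2. *)
have k2h : k2 t * fourier h2 t = - (k2 t * (t ^+ 2)%:C * fourier h t).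
  have [->|t0] := eqVneq t 0.
    rewrite /k2 /outer_part indicE memNset ?mul0r ?oppr0//= normr0.
    by apply/negP; rewrite -leNgt ler01.
  rewrite (fourier_derivative pr2 ih1 ih2 t0) (fourier_derivative pr1 ih ih1 t0).
  rewrite mulrA mulrA -mulrA -mulNr -mulrN mulrA; congr (_ * _).
  rewrite -mulrA; congr (_ * _).
  by apply/eqP; rewrite eq_complex /=; apply/andP; split; apply/eqP; ring.
(* The two signs cancel and k1 + t^2 k2 = f' recombines the parts. *)
rewrite -(inner_outer f' t) -/(k1 t) -/(k2 t).
have -> : k2 t * (fourier g t * fourier h2 t) =
          fourier g t * (k2 t * fourier h2 t) by ring.
by rewrite k2h; ring.
Qed.
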